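(* Let $r$ be a continuously compounded risk-free rate of interest, let $Y=\{Y_t\}_{t\ge0}$ be a Variance-Gamma process with parameters $(\mu t,\delta,\sigma,\alpha t,\theta)$, where $\mu,\delta\in\mathbb{R}$ and $\sigma,\alpha,\theta>0$, and let $(S(0)e^{Y_T}-K)^+$ be the terminal payoff of a contingent claim with expiry date $T$, the asset price being $S(t)=S(0)e^{Y_t}$. Then at time $t<T$ the arbitrage price of the European call option with strike price $K$ can be written $$F_{call}(S_t,t)=\frac{K}{2\pi}\int_{-\infty+iq}^{+\infty+iq}\frac{\exp\left(i\xi\log\frac{S(t)}{K}-\tau\,(r+\varphi(\xi))\right)}{i\xi(i\xi-1)}\,d\xi,$$ where $\tau=T-t$, $q<-1$, and $\varphi$ is the characteristic exponent of the Variance-Gamma model with parameters $(\mu,\tilde\delta,\sigma,\alpha,\tilde\theta)$, $$\varphi(\xi)=-i\mu\xi+\alpha\log\left(1+\tfrac12\tilde\theta\sigma^2\xi^2-i\tilde\delta\tilde\theta\xi\right),\qquad \tilde\delta=\delta+h^*\sigma^2,\qquad \tilde\theta=\frac{\theta}{1-\frac12\theta\sigma^2(h^* )^2-\delta\theta h^*},$$ with $h^*$ the Esscher martingale parameter.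
   Context: A Variance-Gamma (VG) process with parameters $(\mu t,\delta,\sigma,\alpha t,\theta)$ is a Lévy process $Y$ with $$E\left[e^{i\xi Y_t}\right]=\frac{e^{it\mu\xi}}{\left(1-i\delta\theta\xi+\frac12\sigma^2\theta\xi^2\right)^{t\alpha}},\qquad \xi\in\mathbb{R},\ t\ge0.$$ The VG model with parameters $(\mu,\delta,\sigma,\alpha,\theta)$ is the law of $Y_1$, and its characteristic exponent is $-\log E[e^{i\xi Y_1}]$. Let $f(\cdot,t)$ be the probability density of $Y_t$. The moment generating function is $$M(h,t)=E[e^{hY_t}]=\frac{e^{t\mu h}}{\left(1-\frac12\theta\sigma^2h^2-\delta\theta h\right)^{t\alpha}},\quad h_1<h<h_2,$$ $$h_{1}=-\frac{\delta}{\sigma^2}-\sqrt{\frac{\delta^2}{\sigma^4}+\frac{2}{\theta\sigma^2}},\quad h_{2}=-\frac{\delta}{\sigma^2}+\sqrt{\frac{\delta^2}{\sigma^4}+\frac{2}{\theta\sigma^2}}.$$ It is assumed that $h_2-h_1>1$. The Esscher martingale parameter is the unique $h^*\in(h_1,h_2-1)$ with $M(h^*+1,1)/M(h^*,1)=e^{r}$. Under the corresponding equivalent martingale measure, $Y_\tau$ has density $\hat f(x,\tau,h^* )=e^{h^*x}f(x,\tau)/M(h^*,\tau)$, and the arbitrage price at time $t$ is $$F_{call}(S_t,t)=e^{-r\tau}\int_{-\infty}^{+\infty}\hat f(y,\tau,h^* )\,(S(t)e^{y}-K)^+\,dy.$$ The integral in the claim is along the horizontal line $\Im\xi=q$, with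 $\varphi$ at complex arguments given by the displayed formula.
   Formalization: The condition q < -1 is replaced by -(h_2 - h^* ) < q < -1, since for lower q the line passes below the singularity of φ at ξ = -i(h_2 - h^* ) and the formula fails (e.g. for τα = 1 and log(S(t)/K) + τμ ≤ 0 the integral is 0 while the price is positive). *)

(* Defs.v *)
From HB Require Import structures.
From mathcomp Require Import all_boot all_order all_algebra.
From mathcomp Require Import all_classical all_reals all_analysis.
From mathcomp Require Import complex.

Set Implicit Arguments.
Unset Strict Implicit.
Unset Printing Implicit Defensive.

Import Order.TTheory GRing.Theory Num.Theory.
Import numFieldNormedType.Exports.

Local Open Scope classical_set_scope.
Local Open Scope ring_scope.
Local Open Scope complex_scope.

Section complex_functions.
Context {R : realType}.
Implicit Types z : R[i].

Definition cI : R[i] := 0 +i* 1.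

Definition cexp z : R[i] :=
  (expR (complex.Re z))%:C * (cos (complex.Im z) +i* sin (complex.Im z)).

(* Principal argument, with values in ]-pi, pi] for z != 0. *)
Definition carg z : R :=
  let a := acos (complex.Re z / Normc.normc z) in
  if 0 <= complex.Im z then a else - a.

Definition clog z : R[i] := ln (Normc.normc z) +i* carg z.

Definition cpow z (a : R) : R[i] := cexp (a%:C * clog z).

End complex_functions.

Section complex_integral.
Context d (T : measurableType d) (R : realType).
Variable mu : {measure set T -> \bar R}.

Definition cintegrable (g : T -> R[i]) : Prop :=
  mu.-integrable setT (fun x => (complex.Re (g x))%:E) /\
  mu.-integrable setT (fun x => (complex.Im (g x))%:E).

(* To be used only when cintegrable g holds. *)
Definition cintegral (g : T -> R[i]) : R[i] :=
  (\int[mu]_x complex.Re (g x)) +i* (\int[mu]_x complex.Im (g x)).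

End complex_integral.

Section line_integral.
Context {R : realType}.

(* The line Im xi = q is parametrized by xi = u + iq, so that d xi = du. *)
Definition line_integrable (q : R) (g : R[i] -> R[i]) : Prop :=
  cintegrable (@lebesgue_measure R) (fun u : R => g (u +i* q)).

Definition line_integral (q : R) (g : R[i] -> R[i]) : R[i] :=
  cintegral (@lebesgue_measure R) (fun u : R => g (u +i* q)).

End line_integral.

Section processes.
Context d (Omega : measurableType d) (R : realType).
Variable P : probability Omega R.
(* A process indexed by t >= 0; its values at t < 0 are never constrained. *)
Variable Y : R -> {RV P >-> R}.

(* Allowing A i = setT, the product rule over all increments gives mutual
   independence. *)
Definition independent_increments : Prop :=
  forall (n : nat) (t : nat -> R) (A : nat -> set R),
    0 <= t 0 ->
    (forall i, (i < n)%N -> t i <= t i.+1) ->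
    (forall i, (i < n)%N -> measurable (A i)) ->
    P (\bigcap_(i in `I_n) [set w | A i (Y (t i.+1) w - Y (t i) w)]) =
    (\prod_(i < n) P [set w | A i (Y (t i.+1) w - Y (t i) w)%R])%E.

Definition stationary_increments : Prop :=
  forall (s t : R) (A : set R), 0 <= s -> 0 <= t -> measurable A ->
    P [set w | A (Y (s + t) w - Y s w)] = P [set w | A (Y t w)].

Definition stochastically_continuous : Prop :=
  forall t e : R, 0 <= t -> 0 < e ->
    P [set w | e <= `|Y s w - Y t w|] @[s --> within `[0, +oo[ (nbhs t)]
      --> 0%E.

Definition cadlag_path (y : R -> R) : Prop :=
  (forall t, 0 <= t -> y s @[s --> t^'+] --> y t) /\
  (forall t, 0 < t -> cvg (y s @[s --> t^'-])).

Definition levy_process : Prop :=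
  [/\ {ae P, forall w, Y 0 w = 0},
      independent_increments,
      stationary_increments,
      stochastically_continuous &
      {ae P, forall w, cadlag_path (fun t => Y t w)}].

Definition char_fun (X : Omega -> R) (xi : R) : R[i] :=
  cintegral P (fun w => cexp (cI * (xi * X w)%:C)).

(* Variance-Gamma process with parameters
   (mu t, delta, sigma, alpha t, theta). *)
Definition VG_process (mu delta sigma alpha theta : R) : Prop :=
  levy_process /\
  forall t xi : R, 0 <= t ->
    char_fun (Y t) xi =
      cexp (cI * (t * mu * xi)%:C) /
      cpow (1 - cI * (delta * theta * xi)%:C
              + (2^-1 * sigma ^+ 2 * theta * xi ^+ 2)%:C) (t * alpha).

Definition is_density (X : {RV P >-> R}) (g : R -> R) : Prop :=
  [/\ measurable_fun setT g,
      forall x, 0 <= g x &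
      forall A : set R, measurable A ->
        distribution P X A = (\int[lebesgue_measure]_(x in A) (g x)%:E)%E].

(* Used only for h in the interval where the moment generating function of
   Y t is finite. *)
Definition mgf (h t : R) : R := fine ('M_P (Y t) h).

Definition esscher_parameter (r h1 h2 h : R) : Prop :=
  h1 < h < h2 - 1 /\ mgf (h + 1) 1 / mgf h 1 = expR r.

Definition asset_price (S0 t : R) (w : Omega) : R := S0 * expR (Y t w).

(* f x t is the value at x of the density of Y t. *)
Definition esscher_density (f : R -> R -> R) (x tau h : R) : R :=
  expR (h * x) * f x tau / mgf h tau.

Definition call_integrand (f : R -> R -> R) (h K s tau y : R) : R :=
  esscher_density f y tau h * Num.max (s * expR y - K) 0.

Definition call_price (f : R -> R -> R) (r h K s tau : R) : R :=
  expR (- (r * tau)) *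
  \int[lebesgue_measure]_y call_integrand f h K s tau y.

End processes.

Section VG_parameters.
Context {R : realType}.
Implicit Types mu delta sigma alpha theta : R.

Definition VG_h1 delta sigma theta : R :=
  - (delta / sigma ^+ 2)
  - Num.sqrt (delta ^+ 2 / sigma ^+ 4 + 2 / (theta * sigma ^+ 2)).

Definition VG_h2 delta sigma theta : R :=
  - (delta / sigma ^+ 2)
  + Num.sqrt (delta ^+ 2 / sigma ^+ 4 + 2 / (theta * sigma ^+ 2)).

Definition VG_exponent mu delta sigma alpha theta (xi : R[i]) : R[i] :=
  - (cI * mu%:C * xi)
  + alpha%:C * clog (1 + (2^-1 * theta * sigma ^+ 2)%:C * xi ^+ 2
                       - cI * (delta * theta)%:C * xi).

Definition esscher_delta delta sigma h : R := delta + h * sigma ^+ 2.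

Definition esscher_theta delta sigma theta h : R :=
  theta / (1 - 2^-1 * theta * sigma ^+ 2 * h ^+ 2 - delta * theta * h).

Definition call_transform (phi : R[i] -> R[i]) (r K s tau : R) (xi : R[i])
    : R[i] :=
  cexp (cI * xi * (ln (s / K))%:C - tau%:C * (r%:C + phi xi))
  / (cI * xi * (cI * xi - 1)).

End VG_parameters.

(* Main.v *)
(** A Variance-Gamma increment has the law of [m + G1 - G2] with independent
    gamma variables of rates [h2] and [-h1]: the quadratic
    [1 - theta sigma^2 z^2 / 2 - delta theta z] factors as
    [(1 - z / h2) (1 - z / h1)], so both laws have the same characteristic
    function.  The complex moment generating function of a gamma variable is
    obtained along a segment of exponents, where an integration by parts turns
    differentiation under the integral sign into a linear differential
    equation.

    Uniqueness of laws and Fourier inversion both come from the Cauchy kernel,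
    which is the cosine transform of [exp (- e u)] and whose integral over an
    interval is a difference of arctangents: letting [e] tend to 0 recovers the
    mass of the interval.

    With [c = - q > 1], the damped payoff [exp (- c x) (exp x - 1)^+] has
    transform [1 / (z (z - 1))], [z = c + i u], which is integrable, so it is
    recovered by inversion.  Integrating this representation against the law of
    the increment tilted by [exp (hstar x)] and exchanging the integrals gives
    the price as an integral of [M (hstar + z) / M (hstar)]; the factorization
    above identifies this quotient with [exp (- tau phi)]. *)

(* The hypothesis gives the transform of [Y tau] at imaginary exponents only, while the price needs
   it on the vertical line through [hstar + c]. Analytic continuation of an unknown law is avoided:
   a model law is built whose transform is computed directly in the whole strip, and uniqueness of
   laws carries it over to [Y tau]. The condition [hstar - q < h2] puts [hstar + c] inside that
   strip, which gives the law an exponential moment of this order.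

   All integrals are real. A complex identity is stated as a family of cosine identities with a free
   phase: phase 0 is its real part and phase [- pi / 2] its imaginary part. This form survives
   Fubini, sums of independent variables and tilting without any complex integration theory.

   The branch of the logarithm is the other obstacle. The base of each complex power is kept in the
   open right half-plane, where its argument is a difference of arctangents, so that principal
   values agree with the continuous branch along the line of integration. *)
Require Import Defs.
From HB Require Import structures.
From mathcomp Require Import all_boot all_order all_algebra.
From mathcomp Require Import all_classical all_reals all_analysis measurable_realfun.
From mathcomp Require Import complex ring lra.

Set Implicit Arguments.
Unset Strict Implicit.
Unset Printing Implicit Defensive.

Import Order.TTheory GRing.Theory Num.Theory.
Import numFieldNormedType.Exports.

Local Open Scope classical_set_scope.
Local Open Scope ring_scope.
Local Open Scope complex_scope.

(** * Polar form of complex numbers *)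

Section polar.
Context {R : realType}.
Implicit Types (r s a b x y : R).

Definition polar r a : R[i] := (r * cos a) +i* (r * sin a).

Lemma polarM r s a b : polar r a * polar s b = polar (r * s) (a + b).
Proof. by rewrite /polar cosD sinD; simpc; congr (_ +i* _); ring. Qed.

Lemma polar10 : polar 1 0 = 1.
Proof. by rewrite /polar cos0 sin0 mulr1 mulr0. Qed.

Lemma polarV r a : r != 0 -> (polar r a)^-1 = polar r^-1 (- a).
Proof.
move=> r0; have h : polar r^-1 (- a) * polar r a = 1.
  by rewrite polarM mulVf// addNr polar10.
have p0 : polar r a != 0.
  by apply: contra_eq_neq h => ->; rewrite mulr0 eq_sym oner_eq0.
by rewrite -[LHS]mul1r -h mulfK.
Qed.

Lemma cexp_polar x y : cexp (x +i* y) = polar (expR x) y.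
Proof. by rewrite /cexp /polar /=; simpc. Qed.

Lemma normc_polar r a : 0 <= r -> Normc.normc (polar r a) = r.
Proof.
move=> r0; rewrite /polar /= !exprMn -mulrDr cos2Dsin2 mulr1.
by rewrite sqrtr_sqr ger0_norm.
Qed.

(** [carg] takes [acos] of the cosine and restores the sign from the imaginary part [r * sin a]. As
    [acos] inverts [cos] on [[0, pi]] only, the two signs of [a] are treated apart. *)
Lemma carg_polar r a : 0 < r -> - (pi / 2) < a < pi / 2 ->
  carg (polar r a) = a.
Proof.
move=> r0 /andP[a1 a2]; rewrite /carg (normc_polar _ (ltW r0)) /=.
have p0 := pi_gt0 R.
rewrite mulrAC mulfV ?gt_eqF// mul1r pmulr_rge0//.
have [a0|a0] := leP 0 a.
  have h : 0 <= a <= pi by apply/andP; split; lra.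
  by rewrite sin_ge0_pi// cosK// in_itv.
have h : 0 < - a < pi by apply/andP; split; lra.
rewrite leNgt -[sin a]opprK oppr_lt0 -sinN sin_gt0_pi//= -cosN cosK ?opprK//.
by rewrite in_itv/=; apply/andP; split; lra.
Qed.

Lemma clog_polar r a : 0 < r -> - (pi / 2) < a < pi / 2 ->
  clog (polar r a) = ln r +i* a.
Proof.
by move=> r0 ha; rewrite /clog carg_polar// normc_polar// ltW.
Qed.

Lemma cpow_polar r a s : 0 < r -> - (pi / 2) < a < pi / 2 ->
  cpow (polar r a) s = polar (expR (s * ln r)) (s * a).
Proof.
by move=> r0 ha; rewrite /cpow clog_polar//; simpc; rewrite cexp_polar.
Qed.

(** In the right half-plane [atan (y / x)] is the argument. The modulus is written as the
    exponential of half a logarithm so that products and powers of such numbers become sums and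
    multiples of exponents. *)
Lemma gt0_Re_polar x y : 0 < x ->
  x +i* y = polar (expR (2^-1 * ln (x ^+ 2 + y ^+ 2))) (atan (y / x)).
Proof.
move=> x0.
have xy0 : 0 < x ^+ 2 + y ^+ 2 by rewrite ltr_wpDr ?sqr_ge0// exprn_gt0.
set r := expR _.
have r2 : r ^+ 2 = x ^+ 2 + y ^+ 2.
  by rewrite /r -expRM_natl -mulr_natl mulrA mulfV// mul1r lnK.
have r0 : 0 < r by exact: expR_gt0.
have c0 : 0 < cos (atan (y / x)) by rewrite cos_gt0_pihalf// atan_gtNpi2 atan_ltpi2.
have sc : sin (atan (y / x)) = (y / x) * cos (atan (y / x)).
  by rewrite -{2}(atanK (y / x)) /tan divfK// gt_eqF.
have cE : r * cos (atan (y / x)) = x.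
  apply/eqP; rewrite -(eqrXn2 (n:=2))// ?mulr_ge0 ?ltW// exprMn r2.
  have := cos2Dsin2 (atan (y / x)); rewrite sc exprMn.
  set c2 := cos _ ^+ 2 => e.
  have -> : x ^+ 2 + y ^+ 2 = x ^+ 2 * (1 + (y / x) ^+ 2).
    by field; rewrite gt_eqF.
  by rewrite -mulrA mulrDl mul1r e mulr1.
rewrite /polar sc; congr (_ +i* _); first by rewrite cE.
by rewrite mulrCA cE divfK// gt_eqF.
Qed.

End polar.

(** * Calculus on the half-line *)

Section calculus.
Context {R : realType}.
Local Notation mu := (@lebesgue_measure R).
Implicit Types (f g F : R -> R).

Lemma integrable_le d (T : measurableType d) (m : {measure set T -> \bar R})
    (D : set T) (f g : T -> R) : measurable D -> measurable_fun D f ->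
  (forall x, D x -> `|f x| <= g x) -> m.-integrable D (EFin \o g) ->
  m.-integrable D (EFin \o f).
Proof.
move=> mD mf fg; apply: le_integrable => //; first exact/measurable_EFinP.
by move=> x Dx; rewrite /= lee_fin (le_trans (fg _ Dx))// ler_norm.
Qed.

Lemma measurable_fun_within0y f : {within `[0, +oo[, continuous f} ->
  measurable_fun (`[0, +oo[ : set R) f.
Proof. by move=> cf; apply: subspace_continuous_measurable_fun. Qed.

(* Signed version of [ge0_continuous_FTC2y]. *)
Lemma integrable_FTC2y f F (l : R) :
  mu.-integrable `[0, +oo[ (EFin \o f) ->
  {within `[0, +oo[, continuous f} ->
  F x @[x --> +oo] --> l ->
  (forall x : R, 0 < x -> is_derive x 1 F (f x)) -> F x @[x --> 0^'+] --> F 0 ->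
  \int[mu]_(x in `[0, +oo[) f x = l - F 0.
Proof.
move=> intf cf Fl dF F0.
pose D n : set R := `[0, n%:R]%classic.
pose fn n x := ((f \_ (D n)) x)%:E.
have mD : measurable (`[0, +oo[%classic : set R) by [].
have mf := measurable_fun_within0y cf.
(* Truncations of [f] to [[0, n]], dominated by [|f|]; the compact fundamental theorem evaluates
   each of them as [F n - F 0]. *)
have [|||||_ _ h] := @dominated_convergence _ _ _ mu _ mD fn (EFin \o f)
   (abse \o (EFin \o f)).
- move=> n; apply/measurable_EFinP; apply/measurable_restrict => //.
    exact: measurable_itv.
  by apply: measurable_funS mf => //; exact: subIsetl.
- exact/measurable_EFinP.
- apply: aeW => x /=; rewrite in_itv/= andbT => x0.
  apply: cvg_near_cst; near=> n.
  have xn : D n x.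
    by rewrite /D /= in_itv /= x0 /=; near: n; exact: nbhs_infty_ger.
  by rewrite /fn patchE mem_set.
- exact: integrable_abse.
- apply: aeW => x n _; rewrite /fn patchE; case: ifPn => _; first exact: lexx.
  by rewrite abse0; exact: abse_ge0.
have h1 : (F n%:R - F 0) @[n --> \oo] --> \int[mu]_(x in `[0, +oo[) f x.
  move: h; rewrite -[X in _ --> X]fineK; last exact: integrable_fin_num.
  move/fine_cvg; apply: cvg_trans; apply: near_eq_cvg; near=> n => /=.
  have n0 : 0 < n%:R :> R by rewrite ltr0n; near: n; exact: nbhs_infty_gt.
  transitivity (fine (\int[mu]_(x in D n) (f x)%:E)); last first.
    rewrite (@continuous_FTC2 _ f F)//.
    - by move: cf; apply: continuous_subspaceW; exact: subset_itvl.
    - split => //.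
      + by move=> x; rewrite in_itv/= => /andP[x0 _]; have [] := dF x x0.
      + apply: cvg_at_left_filter.
        apply: differentiable_continuous; apply/derivable1_diffP.
        by have [] := dF _ n0.
    - move=> x; rewrite in_itv/= => /andP[x0 _].
      by rewrite derive1E; have [_] := dF x x0.
  congr fine; rewrite integral_mkcond [RHS]integral_mkcond.
  apply: eq_integral => x _; rewrite !patchE /fn patchE.
  case: ifPn => xn; last by case: ifPn => // xD; case/negP: xn; move: xD; rewrite !inE /D/= !in_itv/= => /andP[->].
  by case: ifPn.
have h2 : (F n%:R - F 0) @[n --> \oo] --> l - F 0.
  apply: cvgB; last exact: cvg_cst.
  by apply: (cvg_comp _ _ _ Fl); exact: cvgr_idn.
exact: (cvg_unique _ h1 h2).
Unshelve. all: by end_near. Qed.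


Lemma is_derive_expR_comp f (x d : R) : is_derive x 1 f d ->
  is_derive x 1 (fun y => expR (f y)) (expR (f x) * d).
Proof. by move=> df; exact: (is_derive1_comp (f := expR)). Qed.

Lemma is_derive_cos_comp f (x d : R) : is_derive x 1 f d ->
  is_derive x 1 (fun y => cos (f y)) (- sin (f x) * d).
Proof. by move=> df; exact: (is_derive1_comp (f := cos)). Qed.

Lemma is_derive_sin_comp f (x d : R) : is_derive x 1 f d ->
  is_derive x 1 (fun y => sin (f y)) (cos (f x) * d).
Proof. by move=> df; exact: (is_derive1_comp (f := sin)). Qed.

Lemma is_deriveMR f g (x df dg : R) :
  is_derive x 1 f df -> is_derive x 1 g dg ->
  is_derive x 1 (fun y => f y * g y) (f x * dg + g x * df).
Proof. by move=> hf hg; exact: is_deriveM. Qed.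

Lemma is_deriveDR f g (x df dg : R) :
  is_derive x 1 f df -> is_derive x 1 g dg ->
  is_derive x 1 (fun y => f y + g y) (df + dg).
Proof. by move=> hf hg; exact: is_deriveD. Qed.

Lemma is_derive_affine (a b x : R) : is_derive x 1 (fun y => a + y * b) b.
Proof.
rewrite -[b in X in is_derive _ _ _ X](add0r b).
apply: is_deriveDR.
have := @is_deriveMR id (cst b) x 1 0 (is_derive_id _ _) (is_derive_cst _ _ _).
by rewrite mulr0 add0r mulr1.
Qed.

Lemma is_derive_mulC (c : R) f (x d : R) : is_derive x 1 f d ->
  is_derive x 1 (fun y => c * f y) (c * d).
Proof.
move=> df; have := @is_deriveMR (cst c) f x 0 d (is_derive_cst _ _ _) df.
by rewrite mulr0 addr0.
Qed.

Lemma cvg_inv_pinfty (K : R) : (K / x) @[x --> +oo] --> (0 : R).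
Proof.
apply/cvgrPdist_le => e e0; near=> x.
have x0 : 0 < x by near: x; exact: nbhs_pinfty_gt.
rewrite sub0r normrN normrM normfV (gtr0_norm x0) ler_pdivrMr// mulrC.
rewrite -ler_pdivrMr//; near: x; apply: nbhs_pinfty_ge; exact: num_real.
Unshelve. all: by end_near. Qed.

Lemma integrable_oneDsqrV : mu.-integrable `[0, +oo[ (fun x => ((oneDsqr x)^-1)%:E).
Proof.
apply/integrableP; split.
  apply/measurable_EFinP; apply: measurable_funTS.
  by apply: continuous_measurable_fun => x; exact: continuous_oneDsqrV.
under eq_integral do rewrite gee0_abs ?lee_fin ?invr_ge0 ?oneDsqr_ge0//.
by rewrite integral0y_oneDsqr ltry.
Qed.

Section gamma.
Variable q : R.
Hypothesis q0 : 0 < q.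
Local Notation g v := (v `^ q).

(** The factor [v ^+ 2] serves twice: it yields an integrable majorant of order [1 / (1 + v^2)], and
    it makes the boundary term [v * expR (- (a * v^q))] vanish at infinity. *)
Lemma expR_powR_sqr_bound (a : R) : 0 < a ->
  exists2 K : R, 0 <= K & forall v, 0 <= v ->
    v ^+ 2 * expR (- (a * g v)) <= K.
Proof.
(* With [L = q ln v] the exponent is [(2 / q) L - a exp L], maximal at [L = s] with value
   [(2 / q) (s - 1)]. The bound is the tangent inequality for the exponential at [s]. *)
move=> a0; pose s := ln (2 / (a * q)).
exists (expR (2 / q * (s - 1))); first exact: expR_ge0.
move=> v; rewrite le_eqVlt => /predU1P[<-|v0].
  by rewrite expr2 !mul0r expR_ge0.
have -> : v ^+ 2 = expR (2 * ln v) by rewrite -{1}(lnK v0) expRM_natl.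
rewrite -expRD ler_expR /powR gt_eqF//.
have h : expR (q * ln v - s) >= 1 + (q * ln v - s) by exact: expR_ge1Dx.
have e : expR (q * ln v) = 2 / (a * q) * expR (q * ln v - s).
  rewrite expRB /s lnK ?posrE ?divr_gt0 ?mulr_gt0//.
  by field; rewrite !gt_eqF ?mulr_gt0 ?expR_gt0.
rewrite e.
have -> : a * (2 / (a * q) * expR (q * ln v - s)) = 2 / q * expR (q * ln v - s).
  by field; rewrite !gt_eqF.
have h2 : 2 / q * (1 + (q * ln v - s)) <= 2 / q * expR (q * ln v - s).
  by rewrite ler_wpM2l// divr_ge0// ltW.
have h3 : 2 / q * (q * ln v) = 2 * ln v by field; rewrite gt_eqF.
move: h2 h3; set X := expR _; set L := q * ln v => h2 h3.
rewrite mulrDr mulrBr in h2; rewrite mulrBr; lra.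
Qed.

Lemma powR_cvg_right0 : v `^ q @[v --> 0^'+] --> (0 : R) `^ q.
Proof. by rewrite powR0 ?gt_eqF//; exact: powR_cvg0. Qed.

Lemma within_continuous_powR : {within `[0, +oo[, continuous (fun v : R => v `^ q)}.
Proof.
apply/continuous_within_itvcyP; split; last exact: powR_cvg_right0.
move=> v; rewrite in_itv/= andbT => v0.
apply: differentiable_continuous; apply/derivable1_diffP.
by have [] := is_derive1_powR q v0.
Qed.

Lemma within_continuous_comp_powR (h : R -> R) : continuous h ->
  {within `[0, +oo[, continuous (fun v : R => h (v `^ q))}.
Proof.
move=> ch v; apply: continuous_comp; first exact: within_continuous_powR.
exact: ch.
Qed.

End gamma.

End calculus.

(** * The gamma integral *)

Section gamma_laplace.
Context {R : realType}.
Local Notation mu := (@lebesgue_measure R).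
Variable q : R.
Hypothesis q0 : 0 < q.
Local Notation g v := (v `^ q).
Local Notation D0 := (`[0, +oo[%classic : set R).

Lemma measurable_itv0y : measurable D0.
Proof. exact: measurable_itv. Qed.

Lemma integrable_expR_powR (a : R) : 0 < a ->
  mu.-integrable D0 (fun v => (expR (- (a * g v)))%:E).
Proof.
move=> a0; have [K K0 hK] := expR_powR_sqr_bound q0 a0.
apply: (@integrable_le _ _ _ mu D0 (fun v => expR (- (a * g v))) (fun v => (1 + K) * (oneDsqr v)^-1)).
- exact: measurable_itv0y.
- apply: measurable_fun_within0y.
  apply: (@within_continuous_comp_powR R q q0 (fun x => expR (- (a * x)))) => x.
  apply: (@continuous_comp _ _ _ (fun x => - (a * x)) expR); last exact: continuous_expR.
  by apply: continuousN; apply: mulrl_continuous.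
- move=> v; rewrite /= in_itv/= andbT => v0.
  rewrite ger0_norm ?expR_ge0// ler_pdivlMr ?oneDsqr_gt0// /oneDsqr mulrDr mulr1.
  rewrite lerD//; last by rewrite mulrC hK.
  by rewrite -expR0 ler_expR oppr_le0 mulr_ge0 ?powR_ge0 ?ltW.
- rewrite (_ : _ \o _ = fun v => ((1 + K)%:E * ((oneDsqr v)^-1)%:E)%E)//.
  by apply: integrableZl; [exact: measurable_itv0y|exact: integrable_oneDsqrV].
Qed.

(** Half of the decay absorbs the factor [x], because [(a / 2) x <= exp ((a / 2) x)]; the other half
    remains for integrability. *)
Lemma mulr_expRN_le (a x : R) : 0 < a ->
  x * expR (- (a * x)) <= 2 / a * expR (- (a / 2 * x)).
Proof.
move=> a0.
have -> : expR (- (a * x)) = expR (- (a / 2 * x)) * expR (- (a / 2 * x)).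
  by rewrite -expRD; congr expR; field.
rewrite mulrA ler_wpM2r ?expR_ge0//.
rewrite expRN ler_pdivrMr ?expR_gt0//.
rewrite -(@ler_pM2l _ (a / 2)) ?divr_gt0//.
rewrite mulrA (_ : a / 2 * (2 / a) = 1); last by field; rewrite gt_eqF.
by rewrite mul1r (le_trans _ (expR_ge1Dx _))// lerDr.
Qed.

(* [expR (- A x)] times the real part of [(al - i be) e^(i U x)]. *)
Definition damped_trig (al be A U x : R) : R :=
  expR (- (A * x)) * (al * cos (U * x) + be * sin (U * x)).

Lemma continuous_damped_trig al be A U : continuous (damped_trig al be A U).
Proof.
have h (c : R) : continuous (fun x : R => c * x) by apply: mulrl_continuous.
have hN : continuous (fun x : R => - (A * x)) by move=> x; apply: cvgN; exact: h.
rewrite /damped_trig => x; apply: cvgM.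
  by apply: (@continuous_comp _ _ _ (fun x => - (A * x)) expR); [exact: hN|exact: continuous_expR].
apply: cvgD.
  apply: cvgM; first exact: cvg_cst.
  by apply: (@continuous_comp _ _ _ (fun x => U * x) cos); [exact: h|exact: continuous_cos].
apply: cvgM; first exact: cvg_cst.
by apply: (@continuous_comp _ _ _ (fun x => U * x) sin); [exact: h|exact: continuous_sin].
Qed.

Lemma damped_trig_le al be A U x :
  `|damped_trig al be A U x| <= (`|al| + `|be|) * expR (- (A * x)).
Proof.
rewrite /damped_trig normrM (ger0_norm (expR_ge0 _)) mulrC ler_wpM2r ?expR_ge0//.
rewrite (le_trans (ler_normD _ _))// !normrM lerD// ler_piMr//.
  exact: cos_max.
exact: sin_max.
Qed.

Lemma integrable_damped_trig al be A U : 0 < A ->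
  mu.-integrable D0 (fun v => (damped_trig al be A U (g v))%:E).
Proof.
move=> A0.
apply: (@integrable_le _ _ _ mu D0 (fun v => damped_trig al be A U (g v))
  (fun v => (`|al| + `|be|) * expR (- (A * g v)))).
- exact: measurable_itv0y.
- apply: measurable_fun_within0y.
  by apply: within_continuous_comp_powR => //; exact: continuous_damped_trig.
- by move=> v _; exact: damped_trig_le.
- rewrite (_ : _ \o _ = fun v => ((`|al| + `|be|)%:E * (expR (- (A * g v)))%:E)%E)//.
  by apply: integrableZl; [exact: measurable_itv0y|exact: integrable_expR_powR].
Qed.

Lemma powR_damped_trig_le al be A U v : 0 < A ->
  `|g v * damped_trig al be A U (g v)| <=
  (`|al| + `|be|) * (2 / A * expR (- (A / 2 * g v))).
Proof.
move=> A0; rewrite normrM (ger0_norm (powR_ge0 _ _)).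
rewrite (le_trans (ler_wpM2l (powR_ge0 _ _) (damped_trig_le _ _ _ _ _)))//.
by rewrite mulrCA ler_wpM2l ?addr_ge0// mulr_expRN_le.
Qed.

Lemma integrable_powR_damped_trig al be A U : 0 < A ->
  mu.-integrable D0 (fun v => (g v * damped_trig al be A U (g v))%:E).
Proof.
move=> A0.
apply: (@integrable_le _ _ _ mu D0 (fun v => g v * damped_trig al be A U (g v))
  (fun v => (`|al| + `|be|) * (2 / A * expR (- (A / 2 * g v))))).
- exact: measurable_itv0y.
- apply: measurable_fun_within0y.
  apply: (@within_continuous_comp_powR R q q0 (fun x => x * damped_trig al be A U x)).
  by move=> x; apply: cvgM; [exact: cvg_id|exact: continuous_damped_trig].
- by move=> v _; exact: powR_damped_trig_le.
- rewrite (_ : _ \o _ = fun v => (((`|al| + `|be|) * (2 / A))%:E * (expR (- (A / 2 * g v)))%:E)%E).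
    apply: integrableZl; [exact: measurable_itv0y|apply: integrable_expR_powR].
    by rewrite divr_gt0.
  by apply/funext => v /=; rewrite mulrA EFinM.
Qed.

(** With [x = v^q] and [p = 1 / q] one has [dv = p x^(p-1) dx]. So this is [p] times the integral of
    [x^(p-1)] against [damped_trig], a gamma integral of shape [p]; [dtrig1] carries one more factor
    [x]. *)
Definition dtrig0 al be A U : R :=
  \int[mu]_(v in D0) damped_trig al be A U (g v).
Definition dtrig1 al be A U : R :=
  \int[mu]_(v in D0) (g v * damped_trig al be A U (g v)).

Lemma damped_trig_lin al be A U x : damped_trig al be A U x =
  al * damped_trig 1 0 A U x + be * damped_trig 0 1 A U x.
Proof. by rewrite /damped_trig; ring. Qed.

Lemma dtrig0_lin al be A U : 0 < A -> dtrig0 al be A U =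
  al * dtrig0 1 0 A U + be * dtrig0 0 1 A U.
Proof.
move=> A0; rewrite /dtrig0.
under eq_Rintegral do rewrite damped_trig_lin.
have h c a b : mu.-integrable D0 (fun v => (c * damped_trig a b A U (g v))%:E).
  rewrite (_ : (fun v => _) = fun v => (c%:E * (damped_trig a b A U (g v))%:E)%E)//.
  by apply: integrableZl; [exact: measurable_itv0y|exact: integrable_damped_trig].
rewrite RintegralD ?RintegralZl//; try exact: measurable_itv0y; try exact: h.
- exact: integrable_damped_trig.
- exact: integrable_damped_trig.
Qed.

Lemma dtrig1_lin al be A U : 0 < A -> dtrig1 al be A U =
  al * dtrig1 1 0 A U + be * dtrig1 0 1 A U.
Proof.
move=> A0; rewrite /dtrig1.
under eq_Rintegral do rewrite damped_trig_lin mulrDr (mulrCA _ al) (mulrCA _ be).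
have h c a b : mu.-integrable D0 (fun v => (c * (g v * damped_trig a b A U (g v)))%:E).
  rewrite (_ : (fun v => _) = fun v => (c%:E * (g v * damped_trig a b A U (g v))%:E)%E)//.
  by apply: integrableZl; [exact: measurable_itv0y|exact: integrable_powR_damped_trig].
rewrite RintegralD ?RintegralZl//; try exact: measurable_itv0y; try exact: h.
- exact: integrable_powR_damped_trig.
- exact: integrable_powR_damped_trig.
Qed.


(** The function [v * damped_trig al be A U (v^q)] vanishes at 0 and at infinity, so its derivative
    integrates to 0. Differentiating in [x] turns the coefficients [(al, be)] into
    [- A (al, be) + U (be, - al)]. *)
Lemma dtrig_by_parts al be A U : 0 < A ->
  dtrig0 al be A U = q * (A * dtrig1 al be A U - U * dtrig1 be (- al) A U).
Proof.
move=> A0; pose h a b v := damped_trig a b A U (g v).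
have iZ c (k : R -> R) : mu.-integrable D0 (EFin \o k) ->
    mu.-integrable D0 (fun v => (c * k v)%:E).
  move=> ik; rewrite (_ : (fun v => _) = fun v => (c%:E * (EFin \o k) v)%E)//.
  by apply: integrableZl; [exact: measurable_itv0y|].
have i0 a b : mu.-integrable D0 (fun v => (h a b v)%:E).
  exact: integrable_damped_trig.
have i1 a b : mu.-integrable D0 (fun v => (g v * h a b v)%:E).
  exact: integrable_powR_damped_trig.
(* The derivative of [v * h al be v]; the factor [v * v^(q-1)] from the chain rule recombines into
   [v^q]. *)
pose k v := h al be v - (q * A * (g v * h al be v) - q * U * (g v * h be (- al) v)).
have ik2 : mu.-integrable D0 (fun v =>
    (q * A * (g v * h al be v) - q * U * (g v * h be (- al) v))%:E).
  rewrite (_ : (fun v => _) = fun v => ((q * A * (g v * h al be v))%:E -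
    (q * U * (g v * h be (- al) v))%:E)%E)//.
  by apply: integrableB; [exact: measurable_itv0y|exact: iZ (i1 _ _)|exact: iZ (i1 _ _)].
have ik : mu.-integrable D0 (fun v => (k v)%:E).
  rewrite (_ : (fun v => _) = fun v => ((h al be v)%:E -
    (q * A * (g v * h al be v) - q * U * (g v * h be (- al) v))%:E)%E)//.
  by apply: integrableB; [exact: measurable_itv0y|exact: i0|exact: ik2].
have : \int[mu]_(v in D0) k v = 0 - (0 * h al be 0).
  apply: (@integrable_FTC2y _ k (fun v => v * h al be v)) => //.
  - rewrite /k /h; apply: (@within_continuous_comp_powR R q q0 (fun x =>
      damped_trig al be A U x - (q * A * (x * damped_trig al be A U x) -
      q * U * (x * damped_trig be (- al) A U x)))).
    have cM (c a b : R) : continuous (fun x : R => c * (x * damped_trig a b A U x)).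
      move=> x; apply: cvgM; first exact: cvg_cst.
      by apply: cvgM; [exact: cvg_id|exact: continuous_damped_trig].
    move=> x; apply: cvgB; first exact: continuous_damped_trig.
    by apply: cvgB; exact: cM.
  (* The boundary term at infinity is [v^2 h / v], of order [K / v]. *)
  - have [K K0 hK] := expR_powR_sqr_bound q0 A0.
    apply/norm_cvg0P; apply: (@squeeze_cvgr _ _ _ _ (cst 0)
      (fun v => (`|al| + `|be|) * K / v)) => //; last first.
    + exact: cvg_inv_pinfty.
    + exact: cvg_cst.
    near=> v; have v0 : 0 < v by near: v; exact: nbhs_pinfty_gt.
    rewrite /= normr_ge0/= normrM (gtr0_norm v0) ler_pdivlMr//.
    rewrite (_ : v * _ * v = v ^+ 2 * `|h al be v|); last by ring.
    rewrite (le_trans (ler_wpM2l (sqr_ge0 _) (damped_trig_le _ _ _ _ _)))//.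
    by rewrite mulrCA ler_wpM2l ?addr_ge0// hK// ltW.
  - move=> v v0; have dg := is_derive1_powR q v0.
    have dU : is_derive v 1 (fun v => U * g v) (U * (q * v `^ (q - 1))).
      exact: is_derive_mulC.
    have dA : is_derive v 1 (fun v => - (A * g v)) (- A * (q * v `^ (q - 1))).
      rewrite (_ : (fun v => - (A * g v)) = fun v => (- A) * g v).
        exact: is_derive_mulC.
      by apply/funext => y; rewrite mulNr.
    have dF : is_derive v 1 (fun v => v * h al be v) _ := is_deriveMR (is_derive_id v 1) (is_deriveMR (is_derive_expR_comp dA)
      (is_deriveDR (is_derive_mulC al (is_derive_cos_comp dU))
                   (is_derive_mulC be (is_derive_sin_comp dU)))).
    apply: (is_derive_eq dF).
    have <- : v * v `^ (q - 1) = g v by rewrite mulr_powRB1// ltW.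
    rewrite /k /h /damped_trig -(mulr_powRB1 (ltW v0) q0) /=.
    by ring.
  - apply: cvgM.
      exact: cvg_within.
    have := @within_continuous_comp_powR R q q0 _ (continuous_damped_trig (al := al) (be := be) (A := A) (U := U)).
    by move=> /continuous_within_itvcyP[].
rewrite mul0r subr0 /k (@RintegralB _ _ _ mu _ _ _ measurable_itv0y (i0 al be) ik2).
move/eqP; rewrite subr_eq0 => /eqP; rewrite -/(dtrig0 al be A U) => ->.
rewrite (@RintegralB _ _ _ mu _ _ _ measurable_itv0y (iZ _ _ (i1 _ _)) (iZ _ _ (i1 _ _))).
rewrite !(@RintegralZl _ _ _ mu _ _ _ measurable_itv0y (i1 _ _)).
by rewrite -/(dtrig1 al be A U) -/(dtrig1 be (- al) A U); ring.
Unshelve. all: by end_near. Qed.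

End gamma_laplace.

(** * The gamma integral along a segment of complex exponents *)

Section gamma_laplace_ode.
Context {R : realType}.
Local Notation mu := (@lebesgue_measure R).
Variable q : R.
Hypothesis q0 : 0 < q.
Local Notation g v := (v `^ q).
Local Notation D0 := (`[0, +oo[%classic : set R).

Lemma is_derive_damped_trig (al be a b u s x : R) :
  is_derive s 1 (fun s => damped_trig al be (a + s * b) (s * u) x)
    (- b * (x * damped_trig al be (a + s * b) (s * u) x) +
     u * (x * damped_trig be (- al) (a + s * b) (s * u) x)).
Proof.
have dA : is_derive s 1 (fun s => - ((a + s * b) * x)) (- (b * x)).
  rewrite (_ : (fun _ => _) = fun s => - (a * x) + s * (- (b * x))).
    exact: is_derive_affine.
  by apply/funext => y; ring.
have dU : is_derive s 1 (fun s => s * u * x) (u * x).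
  rewrite (_ : (fun _ => _) = fun s => 0 + s * (u * x)).
    exact: is_derive_affine.
  by apply/funext => y; ring.
have dF : is_derive s 1 (fun s => damped_trig al be (a + s * b) (s * u) x) _ :=
  is_deriveMR (is_derive_expR_comp dA)
      (is_deriveDR (is_derive_mulC al (is_derive_cos_comp dU))
                   (is_derive_mulC be (is_derive_sin_comp dU))).
by apply: (is_derive_eq dF); rewrite /damped_trig; ring.
Qed.

Lemma is_derive_dtrig0 (al be a b u s : R) : 0 < a + s * b ->
  is_derive s 1 (fun s => dtrig0 q al be (a + s * b) (s * u))
    (- b * dtrig1 q al be (a + s * b) (s * u) +
     u * dtrig1 q be (- al) (a + s * b) (s * u)).
Proof.
move=> A0; pose A := a + s * b; rewrite -/A.
pose f s v := damped_trig al be (a + s * b) (s * u) (g v).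
(* Within [eta] of [s] the exponent [a + x * b] moves by at most [eta * (|b| + 1) = A / 2], hence
   stays above [A / 2]. The [+ 1] covers [b = 0]. *)
pose eta := A / (2 * (`|b| + 1)).
have b0 : 0 < `|b| + 1 by rewrite ltr_wpDl.
have eta0 : 0 < eta by rewrite divr_gt0// mulr_gt0.
have hA (x : R) : `]s - eta, s + eta[%classic x -> A / 2 <= a + x * b.
  rewrite /= in_itv/= => /andP[x1 x2].
  have h : `|(x - s) * b| <= eta * (`|b| + 1).
    rewrite normrM ler_pM// ?lerDl// ltW//.
    by rewrite ltr_norml; apply/andP; split; lra.
  have e : eta * (`|b| + 1) = A / 2.
    by rewrite /eta; field; rewrite gt_eqF.
  move: h; rewrite e ler_norml => /andP[h _].
  by rewrite /A; rewrite /A in h; lra.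
(* [mulr_expRN_le] at the rate [A / 2]: the constant becomes [2 / (A / 2) = 4 / A] and the remaining
   rate [A / 4]. *)
pose G v : R := (`|b| + `|u|) * ((`|al| + `|be|) *
  (4 / A * expR (- (A / 4 * g v)))).
have Is : `]s - eta, s + eta[%classic s.
  by rewrite /= in_itv/=; apply/andP; split; lra.
have if_ x : `]s - eta, s + eta[%classic x -> mu.-integrable D0 (EFin \o f x).
  move=> /hA hx; apply: integrable_damped_trig => //.
  by rewrite (lt_le_trans _ hx)// divr_gt0.
have df (x v : R) : is_derive x 1 (f ^~ v) _ :=
  is_derive_damped_trig al be a b u x (g v).
have df1 (x v : R) : `]s - eta, s + eta[%classic x -> D0 v -> derivable (f ^~ v) x 1.
  by move=> _ _; have [] := df x v.
have G0 v : 0 <= G v.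
  by rewrite !mulr_ge0 ?addr_ge0 ?expR_ge0 ?invr_ge0// ltW.
have iG : mu.-integrable D0 (EFin \o G).
  rewrite (_ : _ \o _ = fun v => (((`|b| + `|u|) * ((`|al| + `|be|) *
    (4 / A)))%:E * (expR (- (A / 4 * g v)))%:E)%E); last first.
    by apply/funext => v /=; rewrite /G !mulrA EFinM.
  apply: integrableZl; [exact: measurable_itv0y|apply: integrable_expR_powR => //].
  by rewrite divr_gt0.
have d1E (x v : R) : partial1of2 f x v =
    - b * (g v * damped_trig al be (a + x * b) (x * u) (g v)) +
     u * (g v * damped_trig be (- al) (a + x * b) (x * u) (g v)).
  by rewrite partial1of2E; have [_] := df x v.
have fG (x v : R) : `]s - eta, s + eta[%classic x -> D0 v -> `|partial1of2 f x v| <= G v.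
  move=> /hA hx _; rewrite d1E.
  have hd (c d : R) : `|g v * damped_trig c d (a + x * b) (x * u) (g v)| <=
      (`|c| + `|d|) * (4 / A * expR (- (A / 4 * g v))).
    rewrite normrM (ger0_norm (powR_ge0 _ _)).
    rewrite (le_trans (ler_wpM2l (powR_ge0 _ _) (damped_trig_le _ _ _ _ _)))//.
    rewrite mulrCA ler_wpM2l ?addr_ge0//.
    have A2 : 0 < A / 2 by rewrite divr_gt0.
    have := mulr_expRN_le (g v) A2.
    rewrite (_ : 2 / (A / 2) = 4 / A); last by field; rewrite gt_eqF.
    rewrite (_ : A / 2 / 2 = A / 4); last by field.
    apply: le_trans; rewrite ler_wpM2l ?powR_ge0// ler_expR lerN2.
    by rewrite ler_wpM2r ?powR_ge0.
  rewrite (le_trans (ler_normD _ _))// !(normrM _ (g v * _)) normrN /G mulrDl.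
  by rewrite lerD// ler_wpM2l// (le_trans (hd _ _))// normrN addrC.
have i1 (c d : R) : mu.-integrable D0 (EFin \o (fun v => g v * damped_trig c d (a + s * b) (s * u) (g v))).
  exact: integrable_powR_damped_trig.
have iZ (k c d : R) : mu.-integrable D0 (EFin \o (fun v => k * (g v * damped_trig c d (a + s * b) (s * u) (g v)))).
  rewrite (_ : _ \o _ = fun v => (k%:E * (g v * damped_trig c d (a + s * b) (s * u) (g v))%:E)%E)//.
  by apply: integrableZl; [exact: measurable_itv0y|exact: i1].
apply: DeriveDef.
  exact: (@derivable_under_integral _ _ _ mu f D0 measurable_itv0y s _ _ Is if_ df1 G G0 iG fG).
rewrite -derive1E.
rewrite (@differentiation_under_integral _ _ _ mu f D0 measurable_itv0y s _ _ Is if_ df1 G G0 iG fG).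
under eq_Rintegral do rewrite d1E.
rewrite (@RintegralD _ _ _ mu _ _ _ measurable_itv0y (iZ _ _ _) (iZ _ _ _)).
by rewrite !(@RintegralZl _ _ _ mu _ _ _ measurable_itv0y (i1 _ _)).
Qed.

Lemma is_derive_atan_comp (f : R -> R) (x d : R) : is_derive x 1 f d ->
  is_derive x 1 (fun y => atan (f y)) ((1 + (f x) ^+ 2)^-1 * d).
Proof. by move=> df; exact: (is_derive1_comp (f := atan)). Qed.

Lemma is_derive_ln_comp (f : R -> R) (x d : R) : 0 < f x -> is_derive x 1 f d ->
  is_derive x 1 (fun y => ln (f y)) ((f x)^-1 * d).
Proof.
move=> fx df; have := is_derive1_ln fx.
by move=> dl; exact: (@is_derive1_comp R (@ln R) f x _ _ dl df).
Qed.

Lemma is_derive_inv_comp (f : R -> R) (x d : R) : f x != 0 -> is_derive x 1 f d ->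
  is_derive x 1 (fun y => (f y)^-1) (- (f x) ^- 2 * d).
Proof. by move=> fx df; exact: is_deriveV. Qed.

Section solution.
Variables (a b u : R).
Hypotheses (a0 : 0 < a) (ab0 : 0 < a + b).
Let p := q^-1.
Let A s := a + s * b.
Let U s : R := s * u.
(** [rho] and [- beta] are the modulus and an argument of [(A - i U)^p], and [C + i S] is the
    integral of [exp (- (A - i U) v^q)] over the half-line. Since [A] is positive along the segment,
    [atan (U / A)] is a smooth choice of angle. *)
Let rho s := expR (p * (2^-1 * ln (A s ^+ 2 + U s ^+ 2))).
Let beta s := p * atan (U s * (A s)^-1).
Let C s := dtrig0 q 1 0 (A s) (U s).
Let S s := dtrig0 q 0 1 (A s) (U s).

Let AU0 (s : R) : 0 < A s -> 0 < A s ^+ 2 + U s ^+ 2.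
Proof. by move=> As; rewrite ltr_wpDr ?sqr_ge0// exprn_gt0. Qed.

Let dA (s : R) : is_derive s 1 A b. Proof. exact: is_derive_affine. Qed.

Let dU (s : R) : is_derive s 1 U u.
Proof.
rewrite /U (_ : (fun _ => _) = fun s => 0 + s * u).
  exact: is_derive_affine.
by apply/funext => x; rewrite add0r.
Qed.

Let drho (s : R) : 0 < A s -> is_derive s 1 rho
  (rho s * (p * ((A s * b + U s * u) / (A s ^+ 2 + U s ^+ 2)))).
Proof.
move=> As.
have d2 : is_derive s 1 (fun s => A s ^+ 2 + U s ^+ 2) (2 * (A s * b + U s * u)).
  rewrite (_ : (fun _ => _) = fun s => A s * A s + U s * U s).
    apply: (is_derive_eq (is_deriveDR (is_deriveMR (dA s) (dA s))
      (is_deriveMR (dU s) (dU s)))).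
    by ring.
  by apply/funext => x; rewrite !expr2.
have dl := is_derive_ln_comp (f := fun s => A s ^+ 2 + U s ^+ 2) (AU0 As) d2.
have := is_derive_expR_comp (is_derive_mulC p (is_derive_mulC 2^-1 dl)).
move=> h; apply: (is_derive_eq h); rewrite /rho; congr (_ * (_ * _)).
by field; rewrite gt_eqF ?AU0.
Qed.

Let dbeta (s : R) : 0 < A s -> is_derive s 1 beta
  (p * ((u * A s - U s * b) / (A s ^+ 2 + U s ^+ 2))).
Proof.
move=> As.
have An0 : A s != 0 by rewrite gt_eqF.
have h := is_derive_mulC p (is_derive_atan_comp (f := fun s => U s * (A s)^-1)
  (is_deriveMR (dU s) (is_derive_inv_comp An0 (dA s)))).
apply: (is_derive_eq h); congr (_ * _).
have := AU0 As; move: (A s) (U s) An0 => x y x0 xy0.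
have xy : 1 + (y / x) ^+ 2 != 0.
  by rewrite gt_eqF// ltr_wpDr// sqr_ge0.
by field; rewrite x0 (gt_eqF xy0).
Qed.


Let dC (s : R) : 0 < A s -> is_derive s 1 C
  (- b * dtrig1 q 1 0 (A s) (U s) - u * dtrig1 q 0 1 (A s) (U s)).
Proof.
move=> As; apply: (is_derive_eq (is_derive_dtrig0 1 0 u As)).
rewrite (dtrig1_lin q0 0 (-1) _ As) mul0r add0r.
by rewrite -/(A s) -/(U s); ring.
Qed.

Let dS (s : R) : 0 < A s -> is_derive s 1 S
  (- b * dtrig1 q 0 1 (A s) (U s) + u * dtrig1 q 1 0 (A s) (U s)).
Proof.
by move=> As; apply: (is_derive_eq (is_derive_dtrig0 0 1 u As)); rewrite oppr0.
Qed.

Let CE (s : R) : 0 < A s ->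
  C s = q * (A s * dtrig1 q 1 0 (A s) (U s) + U s * dtrig1 q 0 1 (A s) (U s)).
Proof.
move=> As; rewrite /C (dtrig_by_parts q0 1 0 _ As).
by rewrite (dtrig1_lin q0 0 (-1) _ As); ring.
Qed.

Let SE (s : R) : 0 < A s ->
  S s = q * (A s * dtrig1 q 0 1 (A s) (U s) - U s * dtrig1 q 1 0 (A s) (U s)).
Proof.
by move=> As; rewrite /S (dtrig_by_parts q0 0 1 _ As) oppr0.
Qed.

Let A01 (s : R) : 0 <= s <= 1 -> 0 < A s.
Proof.
move=> /andP[s0 s1]; rewrite /A.
have [b0|b0] := leP 0 b; first by rewrite ltr_wpDr// mulr_ge0.
have : b <= s * b by rewrite -[leLHS]mul1r ler_wnM2r// ltW.
by move: ab0; lra.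
Qed.

(* With [F = C - i S], the exponent being [A - i U], integration by parts reads
   [p F = (A - i U) F1], so that [(A - i U)^p F] does not depend on [s]. *)
Let first_integral (c d : R) (s : R) : 0 < A s ->
  is_derive s 1 (fun s => rho s *
    (C s * (c * cos (beta s) - d * sin (beta s)) +
     S s * (c * sin (beta s) + d * cos (beta s)))) 0.
Proof.
move=> As.
have hc := is_derive_cos_comp (dbeta As).
have hs := is_derive_sin_comp (dbeta As).
have h := is_deriveMR (drho As) (is_deriveDR
  (is_deriveMR (dC As) (is_deriveDR (is_derive_mulC c hc) (is_derive_mulC (- d) hs)))
  (is_deriveMR (dS As) (is_deriveDR (is_derive_mulC c hs) (is_derive_mulC d hc)))).
rewrite (_ : (fun _ => _) = fun s => rho s *
    (C s * (c * cos (beta s) + - d * sin (beta s)) +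
     S s * (c * sin (beta s) + d * cos (beta s)))); last first.
  by apply/funext => x; rewrite mulNr.
apply: (is_derive_eq h); rewrite (CE As) (SE As) /p.
have xy0 := AU0 As; move: xy0.
move: (A s) (U s) (dtrig1 _ _ _ _ _) (dtrig1 _ _ _ _ _) => x y C1 S1 xy0.
move: (rho s) (cos _) (sin _) => r k l.
by field; rewrite !gt_eqF.
Qed.

(** The first integral has the same value at the real exponent [a] ([s = 0]) and at [a + b - i u]
    ([s = 1]). The former contributes only the normalizing constant of the gamma density, the latter
    the quotient of complex powers. *)
Lemma dtrig0_polar (c d : R) :
  c * dtrig0 q 1 0 (a + b) u + d * dtrig0 q 0 1 (a + b) u =
  dtrig0 q 1 0 a 0 *
    expR (- (p * (2^-1 * (ln ((a + b) ^+ 2 + u ^+ 2) - ln (a ^+ 2))))) *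
  (c * cos (p * atan (u / (a + b))) + d * sin (p * atan (u / (a + b)))).
Proof.
have key (m n : R) : rho 1 * (C 1 * (m * cos (beta 1) - n * sin (beta 1)) +
     S 1 * (m * sin (beta 1) + n * cos (beta 1))) =
   rho 0 * (C 0 * m + S 0 * n).
  pose X s := rho s * (C s * (m * cos (beta s) - n * sin (beta s)) +
     S s * (m * sin (beta s) + n * cos (beta s))).
  have dX (s : R) : s \in `]0, 1[ -> is_derive s 1 X ((cst 0 : R -> R) s).
    rewrite in_itv/= => /andP[s0 s1]; apply: first_integral; apply: A01.
    by rewrite !ltW.
  have cX : {within `[0, 1], continuous X}.
    apply: derivable_within_continuous => s; rewrite in_itv/= => s01.
    by have [] := first_integral m n (A01 s01).
  have [x _ ] := MVT ltr01 dX cX.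
  rewrite /= mul0r => /eqP; rewrite subr_eq0 => /eqP; rewrite /X => ->.
  have -> : beta 0 = 0 by rewrite /beta /U !mul0r atan0 mulr0.
  by rewrite cos0 sin0; ring.
have S0 : S 0 = 0.
  rewrite /S /dtrig0 (@eq_Rintegral _ _ _ mu _ (cst 0)).
    by rewrite Rintegral_cst ?mul0r//; exact: measurable_itv0y.
  by move=> v _; rewrite /damped_trig /U !mul0r sin0 !(mul1r, mulr0, addr0).
have A1 : A 1 = a + b by rewrite /A mul1r.
have U1 : U 1 = u by rewrite /U mul1r.
have A0 : A 0 = a by rewrite /A mul0r addr0.
have U0 : U 0 = 0 by rewrite /U mul0r.
pose B := beta 1.
(* Rotating [(c, d)] by the angle [B] cancels the phase at [s = 1], which leaves
   [c * C 1 + d * S 1]. *)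
have := key (c * cos B + d * sin B) (d * cos B - c * sin B).
rewrite -/B S0 mul0r addr0.
have := cos2Dsin2 B; set k := cos B; set l := sin B => kl.
rewrite (_ : C 1 * _ + S 1 * _ = (k ^+ 2 + l ^+ 2) * (c * C 1 + d * S 1)); last by ring.
rewrite kl mul1r => e.
have CE1 : C 1 = dtrig0 q 1 0 (a + b) u by rewrite /C A1 U1.
have SE1 : S 1 = dtrig0 q 0 1 (a + b) u by rewrite /S A1 U1.
have CE0 : C 0 = dtrig0 q 1 0 a 0 by rewrite /C A0 U0.
have BE : B = p * atan (u / (a + b)) by rewrite /B /beta A1 U1.
rewrite -CE1 -SE1 -CE0 -BE -/k -/l.
have r1 : rho 1 != 0 by rewrite gt_eqF// expR_gt0.
apply: (mulfI r1); rewrite e.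
have -> : expR (- (p * (2^-1 * (ln ((a + b) ^+ 2 + u ^+ 2) - ln (a ^+ 2))))) =
    rho 0 / rho 1.
  rewrite /rho A1 U1 A0 U0 expr0n/= addr0 -expRB; congr expR; ring.
by field.
Qed.

End solution.
End gamma_laplace_ode.

(** * Measures with a density *)

Section density.
Local Open Scope ereal_scope.
Context d (T : measurableType d) (R : realType).
Variable m : {measure set T -> \bar R}.
Variable f : T -> R.
Hypotheses (mf : measurable_fun setT f) (f0 : forall x, (0 <= f x)%R).

Lemma density_probability : \int[m]_x (f x)%:E = 1 ->
  exists P : probability T R, forall A, measurable A ->
    P A = \int[m]_(x in A) (f x)%:E.
Proof.
move=> f1; pose nu A := \int[m]_(x in A) (f x)%:E.
have nu0 : nu set0 = 0 by rewrite /nu integral_set0.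
have nu_ge0 A : 0 <= nu A.
  by apply: integral_ge0 => x _; rewrite lee_fin.
have nu_sigma : semi_sigma_additive nu.
  move=> F mF tF mUF; rewrite /nu; apply: cvg_toP.
    apply: ereal_nondecreasing_is_cvgn => i j ij.
    by apply: lee_sum_nneg_natr => // k _ _; exact: nu_ge0.
  rewrite ge0_integral_bigcup//=.
  - exact/measurable_funTS/measurable_EFinP.
  - by move=> x _; rewrite lee_fin.
pose nuM : {measure set T -> \bar R} :=
  HB.pack nu (isMeasure.Build _ _ _ nu nu0 nu_ge0 nu_sigma).
have nuT : nuM setT = 1 by exact: f1.
pose nuP : probability T R := HB.pack nu (Measure.on nuM)
  (@Measure_isProbability.Build _ _ _ nuM nuT).
by exists nuP.
Qed.

Import HBNNSimple.

Lemma ge0_integral_density (nu : {measure set T -> \bar R}) (k : T -> \bar R) :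
  (forall A, measurable A -> nu A = \int[m]_(x in A) (f x)%:E) ->
  measurable_fun setT k -> (forall x, 0 <= k x) ->
  \int[nu]_x k x = \int[m]_x (k x * (f x)%:E).
Proof.
move=> nuE mk k0; pose h := nnsfun_approx measurableT mk.
have mfE : measurable_fun setT (fun x => (f x)%:E) by exact/measurable_EFinP.
have kE x : k x = lim ((h n x)%:E @[n --> \oo]).
  by apply/esym/cvg_lim => //; exact: (cvg_nnsfun_approx measurableT mk (fun x _ => k0 x)).
have hnd x a b : (a <= b)%N -> (h a x <= h b x)%R.
  by move=> ab; exact/lefP/nd_nnsfun_approx.
have -> : \int[nu]_x k x = lim (\int[nu]_x (h n x)%:E @[n --> \oo]).
  under eq_integral do rewrite kE.
  apply: monotone_convergence => //.
  - by move=> n; exact/measurable_EFinP.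
  - by move=> n x _; rewrite lee_fin.
  - by move=> x _ a b ab; rewrite lee_fin; exact: hnd.
have -> : \int[m]_x (k x * (f x)%:E) = lim (\int[m]_x ((h n x)%:E * (f x)%:E) @[n --> \oo]).
  have kfE x : k x * (f x)%:E = lim ((h n x)%:E * (f x)%:E @[n --> \oo]).
    apply/esym/cvg_lim => //; apply: cvgeZr => //.
    exact: (cvg_nnsfun_approx measurableT mk (fun x _ => k0 x)).
  under eq_integral do rewrite kfE.
  apply: monotone_convergence => //.
  - by move=> n; apply: emeasurable_funM => //; exact/measurable_EFinP.
  - by move=> n x _; rewrite mule_ge0// lee_fin.
  - by move=> x _ a b ab; rewrite lee_wpmul2r ?lee_fin//; exact: hnd.
suff hE n : \int[nu]_x (h n x)%:E = \int[m]_x ((h n x)%:E * (f x)%:E).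
  by under eq_fun do rewrite hE.
have indich r : measurable_fun setT (fun x => (r * \1_(h n @^-1` [set r]) x)%:E).
  by apply/measurable_EFinP; exact: measurable_funM.
transitivity (\int[nu]_x
   (\sum_(y \in range (h n)) (y * \1_(h n @^-1` [set y]) x)%:E)).
  by apply: eq_integral => t _; rewrite /= fimfunE -fsumEFin.
rewrite ge0_integral_fsum//; last by move=> y x _; exact: nnfun_muleindic_ge0.
transitivity (\int[m]_x (\sum_(y \in range (h n))
    (y * \1_(h n @^-1` [set y]) x)%:E * (f x)%:E)); last first.
  apply: eq_integral => x _.
  rewrite -ge0_mule_fsuml => [|y]; last exact: nnfun_muleindic_ge0.
  by rewrite fsumEFin // -(fimfunE _ x).
rewrite ge0_integral_fsum//; last 2 first.
  - by move=> y; apply: emeasurable_funM.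
  - by move=> y x _; rewrite mule_ge0 ?lee_fin// -lee_fin nnfun_muleindic_ge0.
apply: eq_fsbigr => r rhn.
have r0 : (0 <= r)%R by move: rhn; rewrite inE => -[x _ <-].
under eq_integral do rewrite EFinM.
rewrite ge0_integralZl//; last exact/measurable_EFinP.
under [RHS]eq_integral do rewrite EFinM -muleA.
rewrite ge0_integralZl//; last 2 first.
  - by apply: emeasurable_funM => //; exact/measurable_EFinP.
  - by move=> x _; rewrite mule_ge0 ?lee_fin.
congr (_ * _).
rewrite integral_indic// setIT nuE// [LHS]integral_mkcond.
apply: eq_integral => x _; rewrite patchE indicE.
by case: ifPn => _; rewrite ?mul1e ?mul0e.
Qed.


Section density_integrable.
Variables (nu : {measure set T -> \bar R}) (k : T -> R).
Hypothesis nuE : forall A, measurable A -> nu A = \int[m]_(x in A) (f x)%:E.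
Hypothesis mk : measurable_fun setT k.
Hypothesis ikf : m.-integrable setT (fun x => (k x * f x)%:E).

Lemma density_integrable : nu.-integrable setT (fun x => (k x)%:E).
Proof.
apply/integrableP; split; first exact/measurable_EFinP.
rewrite (ge0_integral_density nuE)//; last first.
  by apply: measurableT_comp => //; exact/measurable_EFinP.
move/integrableP : ikf => [_]; under eq_integral do rewrite EFinM abseM.
by under eq_integral do rewrite (gee0_abs (x := (f _)%:E)) ?lee_fin//.
Qed.

Lemma integral_density : \int[nu]_x (k x)%:E = \int[m]_x (k x * f x)%:E.
Proof.
have mkE : measurable_fun setT (fun x => (k x)%:E) by exact/measurable_EFinP.
rewrite integralE [RHS]integralE.
rewrite (ge0_integral_density nuE)//; last exact: measurable_funepos.
rewrite (ge0_integral_density nuE)//; last exact: measurable_funeneg.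
congr (_ - _); apply: eq_integral => x _.
  by rewrite !funeposE -!EFin_max -EFinM maxr_pMl// mul0r.
by rewrite !funenegE -!EFinN -!EFin_max -EFinM maxr_pMl// mul0r mulNr.
Qed.

End density_integrable.

End density.

(** * Exponential transform of the gamma law *)

Section gamma_law.
Context {R : realType}.
Local Notation mu := (@lebesgue_measure R).
Variable q : R.
Hypothesis q0 : 0 < q.
Local Notation g v := (v `^ q).
Local Notation D0 := (`[0, +oo[%classic : set R).

Lemma integrable_patch (D : set R) (f : R -> R) : measurable D ->
  mu.-integrable D (EFin \o f) -> mu.-integrable setT (fun v => ((f \_ D) v)%:E).
Proof.
move=> mD fD; rewrite (_ : (fun v => _) = (EFin \o f) \_ D); last first.
  by rewrite restrict_EFin.
by apply/integrable_restrict => //; rewrite setTI.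
Qed.

(** On [[0, 1]] one has [v^q <= 1], so the integrand is at least [expR (- a)] there. *)
Lemma dtrig0_gt0 (a : R) : 0 < a -> 0 < dtrig0 q 1 0 a 0.
Proof.
move=> a0; rewrite /dtrig0.
apply: (@lt_le_trans _ _ (\int[mu]_(v in (`[0, 1]%classic : set R)) expR (- a))).
  rewrite Rintegral_cst//= lebesgue_measure_itv/= lte_fin ltr01/= oppr0 addr0 mulr1.
  exact: expR_gt0.
rewrite Rintegral_mkcond [leRHS]Rintegral_mkcond.
apply: le_Rintegral => //.
- apply: integrable_patch; first exact: measurable_itv.
  apply/integrableP; split; first exact: measurable_cst.
  rewrite (_ : (\int[mu]_(x in _) _)%E = (\int[mu]_(x in `[0%R, 1%R]) (cst (`|expR (- a)|)%:E x))%E)//.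
  by rewrite integral_cst//= lebesgue_measure_itv/= lte_fin ltr01/= oppr0 adde0 mule1 ltry.
- apply: integrable_patch; first exact: measurable_itv0y.
  exact: integrable_damped_trig.
move=> v _; rewrite !patchE.
case: ifPn => [|_].
  rewrite inE/= in_itv/= => /andP[v0 v1].
  rewrite mem_set/= ?in_itv/= ?v0// /damped_trig mul0r cos0 sin0 mul0r addr0 !mulr1.
  rewrite ler_expR lerN2 ler_piMr ?(ltW a0)//.
  rewrite -[leRHS](_ : 1 `^ q = 1); last by rewrite powR1.
  by rewrite ge0_ler_powR// ?ltW// nnegrE.
case: ifPn => // _; rewrite /damped_trig mul0r cos0 sin0 mul0r addr0 !mulr1.
exact: expR_ge0.
Qed.

(* The image of this density by [v |-> v `^ q] is the gamma law of shape [q^-1]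
   and rate [a]; working with [v] removes the singularity at 0 of the usual
   gamma density for shapes below 1. *)
Definition gamma_density (a v : R) : R :=
  ((fun v => expR (- (a * g v)) / dtrig0 q 1 0 a 0) \_ D0) v.

Lemma gamma_density_ge0 (a v : R) : 0 < a -> 0 <= gamma_density a v.
Proof.
move=> a0; rewrite /gamma_density patchE; case: ifPn => // _.
by rewrite divr_ge0 ?expR_ge0// ltW// dtrig0_gt0.
Qed.

Lemma measurable_gamma_density (a : R) : measurable_fun setT (gamma_density a).
Proof.
apply/(measurable_restrict _ measurable_itv0y) => //; rewrite setTI.
apply: measurable_fun_within0y.
apply: (@within_continuous_comp_powR R q q0 (fun x => expR (- (a * x)) / dtrig0 q 1 0 a 0)).
move=> x; apply: cvgM; last exact: cvg_cst.
apply: (@continuous_comp _ _ _ (fun x => - (a * x)) expR); last exact: continuous_expR.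
by apply: cvgN; exact: mulrl_continuous.
Qed.

Lemma gamma_density_trig (a c u k v : R) :
  expR (c * g v) * cos (u * g v + k) * gamma_density a v =
  (dtrig0 q 1 0 a 0)^-1 *
    ((fun v => damped_trig (cos k) (- sin k) (a - c) u (g v)) \_ D0) v.
Proof.
rewrite /gamma_density !patchE; case: ifPn => _; last by rewrite !mulr0.
rewrite /damped_trig cosD mulrBl opprB expRD expRN; ring.
Qed.

Lemma integrable_gamma_density_trig (a c u k : R) : 0 < a - c ->
  mu.-integrable setT
    (fun v => (expR (c * g v) * cos (u * g v + k) * gamma_density a v)%:E).
Proof.
move=> ac0; under eq_fun do rewrite gamma_density_trig EFinM.
apply: integrableZl => //; apply: integrable_patch; first exact: measurable_itv0y.
exact: integrable_damped_trig.
Qed.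

(** The right-hand side has the modulus and the argument of [(1 - z / a)^(- p)] at [z = c + i u],
    with [p = 1 / q]. The free phase [k] makes the cosine identity equivalent to the complex one. *)
Lemma gamma_law (a : R) : 0 < a ->
  exists P : probability (measurableTypeR R) R,
    forall c u : R, 0 < a - c ->
    P.-integrable setT (fun v => (expR (c * g v))%:E) /\
    forall k, \int[P]_v (expR (c * g v) * cos (u * g v + k)) =
      expR (- (q^-1 * (2^-1 * (ln ((a - c) ^+ 2 + u ^+ 2) - ln (a ^+ 2))))) *
      cos (q^-1 * atan (u / (a - c)) + k).
Proof.
move=> a0; have N0 := dtrig0_gt0 a0.
have E (c u k : R) : 0 < a - c ->
    \int[mu]_v (expR (c * g v) * cos (u * g v + k) * gamma_density a v) =
      expR (- (q^-1 * (2^-1 * (ln ((a - c) ^+ 2 + u ^+ 2) - ln (a ^+ 2))))) *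
      cos (q^-1 * atan (u / (a - c)) + k).
  move=> ac0; under eq_Rintegral do rewrite gamma_density_trig.
  rewrite RintegralZl//; last first.
    apply: integrable_patch; first exact: measurable_itv0y.
    exact: integrable_damped_trig.
  rewrite -Rintegral_mkcond -/(dtrig0 q (cos k) (- sin k) (a - c) u).
  rewrite (dtrig0_lin q0 _ _ _ ac0) (dtrig0_polar q0 u a0 ac0) cosD mulNr -!mulrA.
  by rewrite mulKf ?gt_eqF// (mulrC (cos k)) (mulrC (sin k)).
(* The total mass is the transform at [c = u = k = 0]. *)
have f1 : (\int[mu]_v (gamma_density a v)%:E = 1)%E.
  have i0 := @integrable_gamma_density_trig a 0 0 0.
  rewrite subr0 in i0; have {}i0 := i0 a0.
  have := E 0 0 0; rewrite subr0 => /(_ a0).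
  rewrite !mul0r atan0 mulr0 addr0 cos0 expr0n/= addr0 subrr !mulr0 oppr0 expR0 mulr1.
  rewrite /Rintegral => e; rewrite -[RHS]/(1%:E) -{}e fineK; last exact: integrable_fin_num.
  by apply: eq_integral => v _; rewrite !mul0r addr0 expR0 cos0 !mul1r.
have [P PE] := @density_probability _ (measurableTypeR R) R mu _ (measurable_gamma_density a)
  (fun v => gamma_density_ge0 v a0) f1.
have mG := measurable_gamma_density a.
have mk (c u k : R) : measurable_fun setT (fun v : R => expR (c * g v) * cos (u * g v + k)).
  apply: measurable_funM.
    apply: (measurableT_comp (@measurable_expR R)).
    by apply: measurable_funM => //; exact: measurable_powR.
  apply: measurableT_comp; first exact: continuous_measurable_fun (@continuous_cos R).
  apply: measurable_funD => //; apply: measurable_funM => //; exact: measurable_powR.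
exists P => c u ac0; split.
  have := @density_integrable _ (measurableTypeR R) R mu _ mG (fun v => gamma_density_ge0 v a0) P _ PE
    (mk c 0 0) (integrable_gamma_density_trig 0 0 ac0).
  by under eq_fun do rewrite mul0r addr0 cos0 mulr1.
move=> k; rewrite -E// /Rintegral; congr fine.
exact: (@integral_density _ (measurableTypeR R) R mu _ mG (fun v => gamma_density_ge0 v a0) P _ PE (mk c u k)).
Qed.

End gamma_law.

(** * Fubini under domination; Laplace transforms of cosine and sine *)

Section Rfubini.
Context d1 d2 (T1 : measurableType d1) (T2 : measurableType d2) (R : realType).
Variable m1 : {sigma_finite_measure set T1 -> \bar R}.
Variable m2 : {sigma_finite_measure set T2 -> \bar R}.
Variables (h : T1 * T2 -> R) (b : T1 -> R) (c : T2 -> R).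
Hypotheses (mh : measurable_fun setT h)
  (ib : m1.-integrable setT (EFin \o b)) (ic : m2.-integrable setT (EFin \o c))
  (hbc : forall x y, `|h (x, y)| <= b x * c y).

Let integrable_section x : m2.-integrable setT (fun y => (h (x, y))%:E).
Proof.
apply: (@integrable_le _ _ _ m2 setT (fun y => h (x, y)) (fun y => b x * c y)) => //.
  exact: measurableT_comp.
rewrite (_ : _ \o _ = fun y => ((b x)%:E * (c y)%:E)%E)//.
exact: integrableZl.
Qed.

(** Tonelli bounds the integral by the product of the two finite one-variable integrals. All double
    integrals below admit such a product majorant. *)
Lemma product_dominated_integrable : (m1 \x m2)%E.-integrable setT (EFin \o h).
Proof.
apply/integrable12ltyP; first exact/measurable_EFinP.
have bc0 x y : 0 <= b x * c y by exact: le_trans (hbc x y).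
have mb := measurable_int _ ib; have mc := measurable_int _ ic.
apply: (@le_lt_trans _ _ (\int[m1]_x (`|(b x)%:E| * \int[m2]_y `|(c y)%:E|))%E).
  apply: ge0_le_integral => //.
  - by move=> x _; apply: integral_ge0.
  - apply: (measurable_fun_fubini_tonelli_F (fun xy => `|(h xy)%:E|%E)) => //.
    by apply: measurableT_comp => //; exact/measurable_EFinP.
  - apply: emeasurable_funM => //; exact: measurableT_comp.
  move=> x _; rewrite -ge0_integralZl//; last exact: measurableT_comp.
  apply: ge0_le_integral => //.
  - apply: measurableT_comp => //; apply/measurable_EFinP.
    exact: measurableT_comp.
  - by apply: emeasurable_funM => //; exact: measurableT_comp.
  by move=> y _; rewrite -EFinM lee_fin -normrM (le_trans (hbc x y))// ler_norm.
rewrite ge0_integralZr//; last 2 first.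
  - exact: measurableT_comp.
  - exact: integral_ge0.
move/integrableP : ib => [_ ib']; move/integrableP : ic => [_ ic'].
by apply: lte_mul_pinfty => //; [exact: integral_ge0|rewrite ge0_fin_numE//; exact: integral_ge0].
Qed.

Lemma Rfubini : \int[m1]_x (\int[m2]_y h (x, y)) = \int[m2]_y (\int[m1]_x h (x, y)).
Proof.
have ih := product_dominated_integrable.
have i1 y : m1.-integrable setT (fun x => (h (x, y))%:E).
  apply: (@integrable_le _ _ _ m1 setT (fun x => h (x, y)) (fun x => c y * b x)) => //.
  - exact: measurableT_comp.
  - by move=> x _; rewrite mulrC.
  rewrite (_ : _ \o _ = fun x => ((c y)%:E * (b x)%:E)%E)//.
  exact: integrableZl.
rewrite /Rintegral.
under eq_integral => x _ do rewrite fineK ?(integrable_fin_num _ (integrable_section x))//.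
under [in RHS]eq_integral => y _ do rewrite fineK ?(integrable_fin_num _ (i1 y))//.
by congr fine; exact: (Fubini ih).
Qed.

Lemma integral_prod_Rintegral :
  \int[(m1 \x m2)%E]_z h z = \int[m1]_x (\int[m2]_y h (x, y)).
Proof.
have ih := product_dominated_integrable.
rewrite /Rintegral -(integral12_prod_meas1 ih).
by congr fine; apply: eq_integral => x _; rewrite fineK ?(integrable_fin_num _ (integrable_section x)).
Qed.

Lemma integrable_Rintegral :
  m1.-integrable setT (fun x => (\int[m2]_y h (x, y))%:E).
Proof.
have ih := product_dominated_integrable.
apply: eq_integrable (integrable_fubini_F ih) => // x _.
by rewrite /fubini_F /Rintegral fineK ?(integrable_fin_num _ (integrable_section x)).
Qed.

End Rfubini.

(** * Laplace transforms of cosine and sine in closed form *)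

Section laplace_trig.
Context {R : realType}.
Local Notation mu := (@lebesgue_measure R).
Local Notation D0 := (`[0, +oo[%classic : set R).

Lemma integrable_damped_trig1 (al be A U : R) : 0 < A ->
  mu.-integrable D0 (fun v => (damped_trig al be A U v)%:E).
Proof.
move=> A0; apply: eq_integrable (@integrable_damped_trig R 1 ltr01 al be A U A0) => //.
by move=> v; rewrite inE/= in_itv/= andbT => v0; rewrite powRr1.
Qed.

Lemma expRN_le_inv (x : R) : 0 < x -> expR (- x) <= x^-1.
Proof.
move=> x0; rewrite expRN lef_pV2 ?posrE ?expR_gt0//.
by rewrite (le_trans _ (expR_ge1Dx x))// lerDr.
Qed.

Lemma laplace_trig (al be A U : R) : 0 < A ->
  \int[mu]_(v in D0) damped_trig al be A U v = (al * A + be * U) / (A ^+ 2 + U ^+ 2).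
Proof.
move=> A0; have AU : 0 < A ^+ 2 + U ^+ 2 by rewrite ltr_wpDr ?sqr_ge0// exprn_gt0.
(* [m - i n] is [(al - i be) / (- A + i U)], so [damped_trig m n A U] is an antiderivative of the
   integrand. *)
pose m := - (A * al + U * be) / (A ^+ 2 + U ^+ 2).
pose n := (U * al - A * be) / (A ^+ 2 + U ^+ 2).
have dE (al' be' s : R) : damped_trig al' be' (0 + s * A) (s * U) 1 = damped_trig al' be' A U s.
  by rewrite /damped_trig !mulr1 add0r (mulrC s A) (mulrC s U).
transitivity (0 - damped_trig m n A U 0); last first.
  rewrite /damped_trig !mulr0 oppr0 expR0 cos0 sin0 /m.
  by field; rewrite gt_eqF.
apply: integrable_FTC2y.
- exact: integrable_damped_trig1.
- apply/continuous_within_itvcyP; split.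
    by move=> x _; exact: continuous_damped_trig.
  by apply: cvg_at_right_filter; exact: continuous_damped_trig.
- apply/norm_cvg0P; apply: (@squeeze_cvgr _ _ _ _ (cst 0)
      (fun v => (`|m| + `|n|) / A / v)) => //; last first.
  + exact: cvg_inv_pinfty.
  + exact: cvg_cst.
  near=> v; have v0 : 0 < v by near: v; exact: nbhs_pinfty_gt.
  rewrite /= normr_ge0/= (le_trans (damped_trig_le _ _ _ _ _))//.
  rewrite -!mulrA ler_wpM2l ?addr_ge0// -invfM mulrC.
  by rewrite (mulrC v) expRN_le_inv// mulr_gt0.
(* The derivative along a segment of exponents is reused: the segment from 0 with direction
   [(A, U)], at the fixed point 1, is the same function of [x]. *)
- move=> x x0; have := @is_derive_damped_trig R m n 0 A U x 1.
  rewrite (_ : (fun s => _) = damped_trig m n A U); last first.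
    by apply/funext => s; rewrite dE.
  move=> h; apply: (is_derive_eq h); rewrite !dE !mul1r /damped_trig /m /n.
  by field; rewrite gt_eqF.
- by apply: cvg_at_right_filter; exact: continuous_damped_trig.
Unshelve. all: by end_near. Qed.

End laplace_trig.

(** * Cauchy smoothing and uniqueness of laws *)

Lemma Rdominated_cvg d (T : measurableType d) (R : realType)
    (m : {measure set T -> \bar R}) (D : set T) (f_ : nat -> T -> R) (f g : T -> R) :
  measurable D -> (forall n, measurable_fun D (f_ n)) -> measurable_fun D f ->
  {ae m, forall x, D x -> f_ n x @[n --> \oo] --> f x} ->
  m.-integrable D (EFin \o g) -> (forall n x, D x -> `|f_ n x| <= g x) ->
  \int[m]_(x in D) f_ n x @[n --> \oo] --> \int[m]_(x in D) f x.
Proof.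
move=> mD mf_ mf ff ig fg.
have [||||| fi _ h] := @dominated_convergence _ _ _ m _ mD
  (fun n x => (f_ n x)%:E) (fun x => (f x)%:E) (fun x => (g x)%:E).
- by move=> n; exact/measurable_EFinP.
- exact/measurable_EFinP.
- by apply: filterS ff => x h Dx; apply: cvg_EFin; [exact: nearW|exact: h].
- exact: ig.
- by apply: aeW => x n Dx; rewrite lee_fin; exact: fg.
apply: fine_cvg; rewrite fineK; last exact: integrable_fin_num.
exact: h.
Qed.

Section cauchy.
Context {R : realType}.
Local Notation mu := (@lebesgue_measure R).
Local Notation RT := (measurableTypeR R).
Local Notation D0 := (`[0, +oo[%classic : set R).

Lemma measurable_indic_comp d (T : measurableType d) (D : set RT) (z : T -> RT) :
  measurable D -> measurable_fun setT z ->
  measurable_fun setT (fun t => \1_D (z t) : R).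
Proof.
by move=> mD mz; apply: measurableT_comp mz; exact: measurable_indic.
Qed.

Lemma measurable_cosT : measurable_fun setT (@cos R).
Proof. by apply: continuous_measurable_fun; exact: continuous_cos. Qed.

Lemma measurable_atanT : measurable_fun setT (@atan R).
Proof. by apply: continuous_measurable_fun; exact: continuous_atan. Qed.

Lemma is_derive_atan_shift (e y x : R) : 0 < e ->
  is_derive x 1 (fun x => atan ((x - y) / e)) (e / (e ^+ 2 + (x - y) ^+ 2)).
Proof.
move=> e0.
have d1 : is_derive x 1 (fun x => (x - y) / e) e^-1.
  rewrite (_ : (fun _ => _) = fun x => - (y / e) + x * e^-1).
    exact: is_derive_affine.
  by apply/funext => z; ring.
apply: (is_derive_eq (is_derive_atan_comp d1)).
have h : e ^+ 2 + (x - y) ^+ 2 != 0.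
  by rewrite gt_eqF// ltr_wpDr ?sqr_ge0// exprn_gt0.
have h2 : 1 + ((x - y) / e) ^+ 2 != 0 by rewrite gt_eqF// ltr_wpDr ?sqr_ge0.
by field; rewrite h gt_eqF.
Qed.

Lemma continuous_cauchy_kernel (e : R) : 0 < e ->
  continuous (fun x : R => e / (e ^+ 2 + x ^+ 2)).
Proof.
move=> e0 x; apply: cvgM; first exact: cvg_cst.
apply: cvgV.
  by rewrite gt_eqF// ltr_wpDr ?sqr_ge0// exprn_gt0.
by apply: cvgD; [exact: cvg_cst|exact: exprn_continuous].
Qed.

Lemma measurable_cauchy_kernel d (T : measurableType d) (e : R) (z : T -> R) :
  0 < e -> measurable_fun setT z ->
  measurable_fun setT (fun t => e / (e ^+ 2 + (z t) ^+ 2)).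
Proof.
move=> e0 mz; apply: (measurableT_comp (f := fun x : R => e / (e ^+ 2 + x ^+ 2))) => //.
by apply: continuous_measurable_fun; exact: continuous_cauchy_kernel.
Qed.

Lemma cauchy_kernel_bound (e x : R) : 0 < e ->
  0 <= e / (e ^+ 2 + x ^+ 2) <= e^-1.
Proof.
move=> e0; have h : 0 < e ^+ 2 + x ^+ 2.
  by rewrite ltr_wpDr ?sqr_ge0// exprn_gt0.
rewrite divr_ge0 ?(ltW e0) ?(ltW h)//= ler_pdivrMr//.
rewrite -(ler_pM2l e0) mulrA divff ?gt_eqF// mul1r -expr2 lerDl sqr_ge0//.
Qed.

Lemma integrable_indic_mul (D : set RT) (f : RT -> R) : measurable D ->
  mu.-integrable D (EFin \o f) -> mu.-integrable setT (EFin \o (fun x => \1_D x * f x)).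
Proof.
move=> mD fD; apply: eq_integrable (integrable_patch mD fD) => //.
move=> x _ /=; rewrite patchE indicE; case: (x \in D); first by rewrite mul1r.
by rewrite mul0r.
Qed.

Lemma Rintegral_indic_mul (D : set RT) (f : RT -> R) :
  \int[mu]_x (\1_D x * f x) = \int[mu]_(x in D) f x.
Proof.
rewrite [RHS]Rintegral_mkcond; apply: eq_Rintegral => x _.
by rewrite patchE indicE; case: (x \in D); rewrite ?mul1r ?mul0r.
Qed.

Section smoothing.
Variable P : probability RT R.

(** [pi] times the convolution of [P] with the Cauchy density of scale [e]; this accounts for the
    factor [pi] in the limits below. *)
Definition cauchy_smooth (e x : R) : R := \int[P]_y (e / (e ^+ 2 + (x - y) ^+ 2)).

(** The kernel is the Laplace transform at [e] of [u |-> cos (u (x - y))], so Fubini makes the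
    smoothed law a function of the cosine integrals of [P] alone. *)
Lemma fourier_cauchy (e x : R) : 0 < e ->
  cauchy_smooth e x =
  \int[mu]_(u in D0) (expR (- (e * u)) * \int[P]_y cos (u * (x - y))).
Proof.
move=> e0.
pose h (z : RT * RT) : R := (\1_D0 z.2 * expR (- (e * z.2))) * cos (z.2 * (x - z.1)).
have mh : measurable_fun setT h.
  apply: measurable_funM; first apply: measurable_funM.
  - by apply: measurable_indic_comp => //; exact: measurable_itv0y.
  - apply: (measurableT_comp (@measurable_expR R)).
    by apply: measurableT_comp => //; apply: measurable_funM.
  - apply: (measurableT_comp measurable_cosT); apply: measurable_funM => //.
    exact: measurable_funB.
have iexp : mu.-integrable setT (EFin \o (fun u => \1_D0 u * expR (- (e * u)))).
  apply: integrable_indic_mul; first exact: measurable_itv0y.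
  apply: eq_integrable (@integrable_damped_trig1 R 1 0 e 0 e0) => //.
  by move=> u _ /=; rewrite /damped_trig mul0r cos0 mul0r addr0 !mulr1.
have ione : P.-integrable setT (EFin \o (cst 1 : RT -> R)).
  exact: finite_measure_integrable_cst.
have hb (y u : RT) : `|h (y, u)| <= (cst 1 : RT -> R) y * (\1_D0 u * expR (- (e * u))).
  have h0 : 0 <= \1_D0 u * expR (- (e * u)).
    by rewrite mulr_ge0 ?expR_ge0// indicE; case: (_ \in _).
  by rewrite /h /= mul1r normrM (ger0_norm h0) ler_piMr ?cos_max.
have := Rfubini mh ione iexp hb.
have -> : \int[P]_y (\int[mu]_u h (y, u)) = cauchy_smooth e x.
  rewrite /cauchy_smooth; apply: eq_Rintegral => y _; rewrite /h /=.
  under eq_Rintegral do rewrite -mulrA.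
  rewrite Rintegral_indic_mul.
  have := @laplace_trig R 1 0 e (x - y) e0.
  rewrite mul1r mul0r addr0 => <-; apply: eq_Rintegral => u _.
  by rewrite /damped_trig mul1r mul0r addr0 (mulrC u).
move=> ->; rewrite -[RHS]Rintegral_indic_mul; apply: eq_Rintegral => u _.
rewrite /h/= RintegralZl// ?mulrA//.
apply: (@integrable_le _ _ _ P setT (fun y => cos (u * (x - y))) (cst 1)) => //.
- apply: (measurableT_comp measurable_cosT); apply: measurable_funM => //.
  exact: measurable_funB.
- by move=> y _; exact: cos_max.
Qed.

Lemma cauchy_smooth_itv (e a b : R) : 0 < e -> a < b ->
  \int[mu]_(x in `[a, b]) cauchy_smooth e x =
  \int[P]_y (atan ((b - y) / e) - atan ((a - y) / e)).
Proof.
move=> e0 ab.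
pose D := (`[a, b]%classic : set RT).
have mD : measurable D by exact: measurable_itv.
pose h (z : RT * RT) : R := \1_D z.1 * (e / (e ^+ 2 + (z.1 - z.2) ^+ 2)).
have mh : measurable_fun setT h.
  apply: measurable_funM.
    exact: measurable_indic_comp.
  by apply: measurable_cauchy_kernel => //; exact: measurable_funB.
have ib : mu.-integrable setT (EFin \o (fun x => \1_D x * e^-1)).
  apply: integrable_indic_mul => //.
  apply: continuous_compact_integrable; first exact: segment_compact.
  by apply: continuous_subspaceT => x; exact: cvg_cst.
have ione : P.-integrable setT (EFin \o (cst 1 : RT -> R)).
  exact: finite_measure_integrable_cst.
have hb (x y : RT) : `|h (x, y)| <= \1_D x * e^-1 * (cst 1 : RT -> R) y.
  have /andP[k0 k1] := cauchy_kernel_bound (x - y) e0.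
  have i0 : 0 <= \1_D x :> R by rewrite indicE; case: (_ \in _).
  rewrite /h /= mulr1 (ger0_norm (mulr_ge0 i0 k0)).
  exact: ler_wpM2l.
have := Rfubini mh ib ione hb.
have -> : \int[mu]_x (\int[P]_y h (x, y)) = \int[mu]_(x in `[a, b]) cauchy_smooth e x.
  rewrite -[RHS]Rintegral_indic_mul; apply: eq_Rintegral => x _.
  rewrite /h /= RintegralZl//.
  apply: (@integrable_le _ _ _ P setT (fun y => e / (e ^+ 2 + (x - y) ^+ 2)) (cst e^-1)) => //.
  - by apply: measurable_cauchy_kernel => //; exact: measurable_funB.
  - by move=> y _; have /andP[k0 k1] := cauchy_kernel_bound (x - y) e0; rewrite ger0_norm.
  - exact: finite_measure_integrable_cst.
move=> ->; apply: eq_Rintegral => y _; rewrite /h /= Rintegral_indic_mul /D.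
rewrite /Rintegral (@continuous_FTC2 _ _ (fun x => atan ((x - y) / e)))//.
- apply: continuous_subspaceT => x.
  apply: (@continuous_comp _ _ _ (fun x => x - y) (fun x => e / (e ^+ 2 + x ^+ 2))).
    by apply: cvgB; [exact: cvg_id|exact: cvg_cst].
  exact: continuous_cauchy_kernel.
- have dc (x : R) : {for x, continuous (fun x : R => atan ((x - y) / e))}.
    apply: differentiable_continuous; apply/derivable1_diffP.
    by have [] := is_derive_atan_shift y x e0.
  split.
  + by move=> x _; have [] := is_derive_atan_shift y x e0.
  + by apply: cvg_at_right_filter; exact: dc.
  + by apply: cvg_at_left_filter; exact: dc.
- move=> x _; rewrite derive1E.
  by have [_] := is_derive_atan_shift y x e0.
Qed.

End smoothing.

Lemma cvg_atan_pinfty (s : nat -> R) : s n @[n --> \oo] --> +oo ->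
  atan (s n) @[n --> \oo] --> (pi / 2 : R).
Proof. by move=> h; exact: (cvg_comp _ _ h (@cvgy_atan R)). Qed.

Lemma cvg_atan_ninfty (s : nat -> R) : (- s n) @[n --> \oo] --> +oo ->
  atan (s n) @[n --> \oo] --> (- (pi / 2) : R).
Proof.
move=> h; rewrite (_ : (fun n => atan (s n)) = fun n => - atan (- s n)).
  by apply: cvgN; exact: cvg_atan_pinfty.
by apply/funext => n; rewrite atanN opprK.
Qed.

End cauchy.

(** * Removing the smoothing: a law is determined by its cosine integrals *)

Section uniqueness.
Context {R : realType}.
Local Notation mu := (@lebesgue_measure R).
Local Notation RT := (measurableTypeR R).
Local Notation D0 := (`[0, +oo[%classic : set R).
Local Notation N n := (n.+1%:R : R).

(** The quotient is [x N^2 + N]. The term [N], due to the shift, settles the case [x = 0], where an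
    atom may sit at an endpoint. *)
Lemma cvg_Nr_shift (x : R) : 0 <= x ->
  (x + (N n)^-1) / (N n)^-1 ^+ 2 @[n --> \oo] --> +oo.
Proof.
move=> x0; apply/cvgryPge => A; near=> n.
have N0 : 0 < N n by rewrite ltr0n.
have -> : (x + (N n)^-1) / (N n)^-1 ^+ 2 = x * (N n * N n) + N n.
  by field; rewrite gt_eqF.
rewrite (@le_trans _ _ (N n))//.
  rewrite (@le_trans _ _ n%:R) ?ler_nat//.
  by near: n; exact: nbhs_infty_ger.
by rewrite lerDr mulr_ge0// mulr_ge0// ltW.
Unshelve. all: by end_near. Qed.

Lemma cvg_Nr_shiftN (x : R) : x < 0 ->
  - ((x + (N n)^-1) / (N n)^-1 ^+ 2) @[n --> \oo] --> +oo.
Proof.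
move=> x0; apply/cvgryPge => A; near=> n.
have N0 : 0 < N n by rewrite ltr0n.
have -> : - ((x + (N n)^-1) / (N n)^-1 ^+ 2) = N n * (- x * N n - 1).
  by field; rewrite gt_eqF.
rewrite (@le_trans _ _ (N n))//.
  rewrite (@le_trans _ _ n%:R) ?ler_nat//.
  by near: n; exact: nbhs_infty_ger.
apply: ler_peMr; first exact: ltW.
rewrite lerBrDr -ler_pdivrMl ?oppr_gt0//.
rewrite (@le_trans _ _ n%:R) ?ler_nat//.
by near: n; exact: nbhs_infty_ger.
Unshelve. all: by end_near. Qed.

Lemma cvg_atan_shift (x : R) :
  atan ((x + (N n)^-1) / (N n)^-1 ^+ 2) @[n --> \oo] -->
  (if 0 <= x then pi / 2 else - (pi / 2) : R).
Proof.
case: ifPn => [x0|]; first by apply: cvg_atan_pinfty; exact: cvg_Nr_shift.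
by rewrite -ltNge => x0; apply: cvg_atan_ninfty; exact: cvg_Nr_shiftN.
Qed.

Section limits.
Variable P : probability RT R.

Let bnd (s t : R) : `|atan s - atan t| <= pi.
Proof.
have := atan_gtNpi2 s; have := atan_ltpi2 s.
have := atan_gtNpi2 t; have := atan_ltpi2 t => h1 h2 h3 h4.
by rewrite ler_norml; apply/andP; split; lra.
Qed.

Let lim_fun (a b y : R) : a < b ->
  (if 0 <= b - y then pi / 2 else - (pi / 2) : R) -
  (if 0 <= a - y then pi / 2 else - (pi / 2) : R) = pi * \1_(`]a, b]%classic : set RT) y.
Proof.
move=> ab; rewrite indicE !subr_ge0.
have [ya|ya] := leP y a.
  rewrite (le_trans ya (ltW ab)) subrr memNset ?mulr0//= in_itv/=.
  by rewrite ltNge ya.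
have [yb|yb] := leP y b.
  by rewrite mem_set/= ?in_itv/= ?ya ?yb// mulr1; lra.
by rewrite memNset/= ?in_itv/= ?ya/= ?leNgt ?yb// mulr0; lra.
Qed.

Let measurable_F (a b e : R) :
  measurable_fun setT (fun y : RT => atan ((b - y) / e) - atan ((a - y) / e)).
Proof.
apply: measurable_funB; apply: (measurableT_comp measurable_atanT);
  by apply: measurable_funM => //; exact: measurable_funB.
Qed.

Let measurable_oc (a b : R) : measurable (`]a, b]%classic : set RT).
Proof. exact: measurable_itv. Qed.

Let Rintegral_oc (a b : R) :
  \int[P]_y (pi * \1_(`]a, b]%classic : set RT) y) = pi * fine (P `]a, b]%classic).
Proof.
rewrite RintegralZl//.
  congr (_ * _); rewrite /Rintegral integral_indic ?setIT//; exact: measurable_oc.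
apply: (@integrable_le _ _ _ P setT (\1_(`]a, b]%classic : set RT)) (cst 1)) => //.
- by move=> x _; rewrite indicE; case: (_ \in _); rewrite ?normr1 ?normr0.
- exact: finite_measure_integrable_cst.
Qed.

(* Shifting the interval by [1/N], much larger than the width [1/N^2] of the
   kernel, gives the endpoints the weights 0 and 1 instead of 1/2. *)
Lemma cauchy_smooth_cvg (a b : R) : a < b ->
  \int[mu]_(x in `[a + (N n)^-1, b + (N n)^-1]) cauchy_smooth P ((N n)^-1 ^+ 2) x
    @[n --> \oo] --> pi * fine (P `]a, b]%classic).
Proof.
move=> ab.
rewrite -Rintegral_oc (_ : (fun n => _) = fun n => \int[P]_y (
    atan ((b + (N n)^-1 - y) / (N n)^-1 ^+ 2) -
    atan ((a + (N n)^-1 - y) / (N n)^-1 ^+ 2))); last first.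
  apply/funext => n; apply: cauchy_smooth_itv; last by rewrite ltrD2r.
  by rewrite exprn_gt0// invr_gt0 ltr0n.
apply: (@Rdominated_cvg _ _ _ P setT _ _ (cst pi)) => //.
- apply: measurable_funM => //; apply: measurable_indic; exact: measurable_oc.
- apply: aeW => y _; rewrite -lim_fun//; apply: cvgB.
    rewrite (_ : (fun n => _) = fun n => atan ((b - y + (N n)^-1) / (N n)^-1 ^+ 2)).
      exact: cvg_atan_shift.
    by apply/funext => n; rewrite addrAC.
  rewrite (_ : (fun n => _) = fun n => atan ((a - y + (N n)^-1) / (N n)^-1 ^+ 2)).
    exact: cvg_atan_shift.
  by apply/funext => n; rewrite addrAC.
- exact: finite_measure_integrable_cst.
Qed.

Lemma cvg_atan_Nr (x : R) : x != 0 ->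
  atan (x / (N n)^-1) @[n --> \oo] --> (if 0 <= x then pi / 2 else - (pi / 2) : R).
Proof.
have h (z : R) : 0 < z -> z / (N n)^-1 @[n --> \oo] --> +oo.
  move=> z0; apply/cvgryPge => A; near=> n; rewrite invrK -ler_pdivrMl//.
  rewrite (@le_trans _ _ n%:R) ?ler_nat//.
  by near: n; exact: nbhs_infty_ger.
rewrite neq_lt => /orP[x0|x0].
  rewrite leNgt x0/=; apply: cvg_atan_ninfty.
  under eq_fun do rewrite -mulNr.
  by apply: h; rewrite oppr_gt0.
by rewrite ltW//; apply: cvg_atan_pinfty; exact: h.
Unshelve. all: by end_near. Qed.

(** When the endpoints carry no mass the pointwise limit holds almost everywhere without a shift, so
    the interval stays fixed; the comparison over a fixed [[a, b]] in [call_tilt_inversion] relies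
    on this. *)
Lemma cauchy_smooth_cvg_atomless (a b : R) : a < b ->
  P [set a] = 0%E -> P [set b] = 0%E ->
  \int[mu]_(x in `[a, b]) cauchy_smooth P (N n)^-1 x
    @[n --> \oo] --> pi * fine (P `]a, b]%classic).
Proof.
move=> ab Pa Pb.
rewrite -Rintegral_oc (_ : (fun n => _) = fun n => \int[P]_y (
    atan ((b - y) / (N n)^-1) - atan ((a - y) / (N n)^-1))); last first.
  by apply/funext => n; apply: cauchy_smooth_itv => //; rewrite invr_gt0 ltr0n.
apply: (@Rdominated_cvg _ _ _ P setT _ _ (cst pi)) => //.
- apply: measurable_funM => //; apply: measurable_indic; exact: measurable_oc.
- have aen (c : R) : P [set c] = 0%E -> {ae P, forall y : RT, c - y != 0}.
    move=> Pc; exists [set c]; split => //.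
    by move=> y /= /negP; rewrite negbK subr_eq0 => /eqP.
  apply: filterS2 (aen a Pa) (aen b Pb) => y ay yb _.
  by rewrite -lim_fun//; apply: cvgB; exact: cvg_atan_Nr.
- exact: finite_measure_integrable_cst.
Qed.

End limits.

(** With [x] free, these cosines record both parts of the characteristic function. They determine
    the smoothed laws, hence the masses of the half-open intervals, an intersection-stable
    generating family. *)
Lemma law_unique (P1 P2 : probability RT R) :
  (forall u x : R, \int[P1]_y cos (u * (x - y)) = \int[P2]_y cos (u * (x - y))) ->
  forall A, measurable A -> P1 A = P2 A.
Proof.
move=> h.
have e (n : nat) (x : R) :
    cauchy_smooth P1 ((N n)^-1 ^+ 2) x = cauchy_smooth P2 ((N n)^-1 ^+ 2) x.
  have e0 : 0 < (N n)^-1 ^+ 2 by rewrite exprn_gt0// invr_gt0 ltr0n.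
  rewrite !fourier_cauchy//; apply: eq_Rintegral => u _.
  by rewrite h.
have oc (a b : R) : P1 `]a, b]%classic = P2 `]a, b]%classic.
  have [ab|ba] := ltP a b; last by rewrite set_itv_ge ?bnd_simp ?measure0 -?leNgt.
  have c1 := @cauchy_smooth_cvg P1 _ _ ab.
  have := @cauchy_smooth_cvg P2 _ _ ab.
  under eq_fun do under eq_Rintegral do rewrite -e.
  move=> /(cvg_unique _ c1)/(mulfI _) E.
  have /E {}E : (pi : R) != 0 by rewrite gt_eqF// pi_gt0.
  have f1 : P1 `]a, b]%classic \is a fin_num.
    by apply: fin_num_measure; exact: measurable_itv.
  have f2 : P2 `]a, b]%classic \is a fin_num.
    by apply: fin_num_measure; exact: measurable_itv.
  rewrite -(fineK f1) -(fineK f2); congr (_%:E); apply: E.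
  exact: norm_hausdorff.
move=> A mA; apply: (@measure_unique _ R RT (@ocitv R)
   (fun k => `](- k%:R), k%:R]%classic)) => //.
- exact: ocitvI.
- by move=> k; exists (- k%:R, k%:R).
- apply/seteqP; split => // x _; exists (Num.truncn `|x|).+1 => //=.
  have := truncnS_gt `|x|; rewrite in_itv/= => hx.
  by have := hx; rewrite ltr_norml => /andP[-> /ltW ->].
- by move=> _ [[a b] _ <-] /=; exact: oc.
- by move=> k; rewrite (le_lt_trans (probability_le1 _ _)) ?ltry.
Qed.

End uniqueness.

(** * Fourier inversion of the damped call payoff *)

Section reflection.
Context {R : realType}.
Local Notation mu := (@lebesgue_measure R).
Local Notation RT := (measurableTypeR R).
Local Notation D0 := (`[0, +oo[%classic : set R).

Lemma integral_reflection (f : RT -> R) : measurable_fun setT f ->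
  mu.-integrable D0 (EFin \o f) -> mu.-integrable D0 (fun x => (f (- x))%:E) ->
  mu.-integrable setT (EFin \o f) /\
  \int[mu]_x f x = \int[mu]_(x in D0) f x + \int[mu]_(x in D0) f (- x).
Proof.
move=> mf i1 i2.
pose E := (`]-oo, 0]%classic : set RT).
have mN : measurable_fun setT (-%R : RT -> RT) by apply: (@oppr_measurable R).
have DE : (-%R : RT -> RT) @^-1` E = D0.
  by apply/seteqP; split=> x; rewrite /E /= !in_itv/= andbT oppr_le0.
have mE : measurable E by exact: measurable_itv.
have mfE : measurable_fun setT (EFin \o f) by exact/measurable_EFinP.
have i2' : mu.-integrable ((-%R : RT -> RT) @^-1` E) ((EFin \o f) \o (-%R : RT -> RT)).
  by rewrite DE.
have pE A : measurable A -> A `<=` E -> pushforward mu (-%R : RT -> RT) A = mu A.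
  by move=> mA _; exact: lebesgue_measureN.
have iE : mu.-integrable E (EFin \o f).
  have /integrableP[_ h] := integrable_pushforward mN mfE i2' mE.
  apply/integrableP; split; first exact: measurable_funTS.
  by rewrite (eq_measure_integral (pushforward mu (-%R : RT -> RT)))// => A mA AE; exact/esym/pE.
have eE : \int[mu]_(x in E) f x = \int[mu]_(x in D0) f (- x).
  rewrite /Rintegral -DE -(integral_pushforward mN mfE i2' mE); congr fine.
  by apply: eq_measure_integral => A mA AE; exact/esym/pE.
(* Reflection produces the closed half-line [E]; the null point 0 is dropped to get a partition of
   the line with [D0]. *)
pose E' := (`]-oo, 0[%classic : set RT).
have mE' : measurable E' by exact: measurable_itv.
have iE' : mu.-integrable E' (EFin \o f).
  apply: integrableS iE => //.
  by move=> x; rewrite /E /E' /= !in_itv/=; exact: ltW.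
have eE' : \int[mu]_(x in E') f x = \int[mu]_(x in E) f x.
  exact: Rintegral_itv_bndo_bndc.
have TE : setT = E' `|` D0 :> set RT.
  apply/seteqP; split => // x _; rewrite /E' /= !in_itv/= andbT.
  by case: (ltP x 0) => h; [left|right].
have dis : [disjoint E' & D0].
  apply/disj_setPS => x; rewrite /E' /= !in_itv/= andbT => -[h1 h2].
  by have := lt_le_trans h1 h2; rewrite ltxx.
have iT : mu.-integrable setT (EFin \o f).
  apply/integrableP; split=> //.
  rewrite TE ge0_integral_setU//.
  - move/integrableP : iE' => [_ h1]; move/integrableP : i1 => [_ h2].
    by rewrite lte_add_pinfty.
  - rewrite -TE; exact: measurableT_comp.
split => //; rewrite {1}TE Rintegral_setU//.
- by rewrite eE' eE addrC.
- by rewrite -TE.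
Qed.

End reflection.

(** * The damped payoff and its half-line inversion formula *)

Section payoff.
Context {R : realType}.
Local Notation mu := (@lebesgue_measure R).
Local Notation RT := (measurableTypeR R).
Local Notation D0 := (`[0, +oo[%classic : set R).
Local Notation N n := (n.+1%:R : R).

Lemma integrable_lorentz (k : R) : 0 < k ->
  mu.-integrable D0 (fun u => ((k ^+ 2 + u ^+ 2)^-1)%:E).
Proof.
move=> k0.
apply: (@integrable_le R _ RT mu D0 (fun u => (k ^+ 2 + u ^+ 2)^-1)
   (fun u => (1 + k ^- 2) * (oneDsqr u)^-1)).
- exact: measurable_itv0y.
- apply: measurable_funTS; apply: continuous_measurable_fun => x.
  apply: cvgV; first by rewrite gt_eqF// ltr_wpDr ?sqr_ge0// exprn_gt0.
  by apply: cvgD; [exact: cvg_cst|exact: exprn_continuous].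
- move=> u _; have h : 0 < k ^+ 2 + u ^+ 2 by rewrite ltr_wpDr ?sqr_ge0// exprn_gt0.
  rewrite ger0_norm ?invr_ge0 ?(ltW h)// ler_pdivlMr ?oneDsqr_gt0// ler_pdivrMl//.
  rewrite /oneDsqr (_ : (k ^+ 2 + u ^+ 2) * (1 + k ^- 2) =
    1 + u ^+ 2 + (k ^+ 2 + u ^+ 2 / k ^+ 2)); last by field; rewrite gt_eqF.
  by rewrite lerDl addr_ge0 ?sqr_ge0// divr_ge0 ?sqr_ge0.
- rewrite (_ : _ \o _ = fun u => ((1 + k ^- 2)%:E * ((oneDsqr u)^-1)%:E)%E)//.
  by apply: integrableZl; [exact: measurable_itv0y|exact: integrable_oneDsqrV].
Qed.

(** By continuity [f x] is the derivative at [x] of the integral of [f] from [x - 1], and this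
    integral is identically 0. *)
Lemma continuous_itv_integral0 (f : R -> R) : continuous f ->
  (forall a b, a < b -> \int[mu]_(x in `[a, b]) f x = 0) -> forall x, f x = 0.
Proof.
move=> cf f0 x.
have iF : mu.-integrable `[x - 1, x + 1] (EFin \o f).
  apply: continuous_compact_integrable; first exact: segment_compact.
  exact: continuous_subspaceT.
have x1 : x < x + 1 by rewrite ltrDl.
have x2 : x - 1 < x by rewrite ltrBlDr ltrDl.
have [_ <-] := continuous_FTC1_closed x1 iF x2 (cf x).
rewrite (_ : (fun y => _) = cst 0) ?derive1_cst//.
apply/funext => y; have [h|h] := ltP (x - 1) y; first exact: f0.
move: h; rewrite le_eqVlt => /predU1P[->|h].
  by rewrite set_itv1 Rintegral_set1.
by rewrite set_itv_ge ?bnd_simp -?ltNge// Rintegral_set0.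
Qed.

(* With [z = c + i u], [1 / (z (z - 1)) = chat c u - i shat c u]. *)
Definition chat (c u : R) : R :=
  (c - 1) / ((c - 1) ^+ 2 + u ^+ 2) - c / (c ^+ 2 + u ^+ 2).
Definition shat (c u : R) : R :=
  u / ((c - 1) ^+ 2 + u ^+ 2) - u / (c ^+ 2 + u ^+ 2).

Section fixed.
Variable c : R.
Hypothesis c1 : 1 < c.
Let k := c - 1.
Let k0 : 0 < k. Proof. by rewrite subr_gt0. Qed.
Let c0 : 0 < c. Proof. exact: lt_trans c1. Qed.

Let ku (u : R) : 0 < k ^+ 2 + u ^+ 2.
Proof. by rewrite ltr_wpDr ?sqr_ge0// exprn_gt0. Qed.
Let cu (u : R) : 0 < c ^+ 2 + u ^+ 2.
Proof. by rewrite ltr_wpDr ?sqr_ge0// exprn_gt0. Qed.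

Lemma chat_bound (u : R) : `|chat c u| <= (k ^+ 2 + u ^+ 2)^-1.
Proof.
have -> : chat c u = (k * c - u ^+ 2) / (c ^+ 2 + u ^+ 2) * (k ^+ 2 + u ^+ 2)^-1.
  by rewrite /chat -/k /k; field; rewrite !gt_eqF//; have := ku u.
rewrite normrM (ger0_norm (_ : 0 <= (k ^+ 2 + u ^+ 2)^-1)) ?invr_ge0 ?(ltW (ku u))//.
rewrite ler_piMl ?invr_ge0 ?(ltW (ku u))// normrM normfV (gtr0_norm (cu u)).
rewrite ler_pdivrMr// mul1r ler_norml.
have kc : k * c <= c ^+ 2 by rewrite expr2 ler_wpM2r ?(ltW c0)// /k; lra.
have kc0 : 0 <= k * c by rewrite mulr_ge0 ?ltW.
have u2 := sqr_ge0 u; have c2 := sqr_ge0 c.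
by apply/andP; split; lra.
Qed.

(** Each of the two terms is only of order [1 / u]; over a common denominator the leading parts
    cancel, because [c ^+ 2 - k ^+ 2 = 2 * c - 1] is constant in [u], and an integrable bound
    results. *)
Lemma shat_bound (u : R) : `|shat c u| <= (k ^+ 2 + u ^+ 2)^-1.
Proof.
have -> : shat c u = (2 * c - 1) * u / (c ^+ 2 + u ^+ 2) * (k ^+ 2 + u ^+ 2)^-1.
  by rewrite /shat -/k /k; field; rewrite !gt_eqF//; have := ku u.
rewrite normrM (ger0_norm (_ : 0 <= (k ^+ 2 + u ^+ 2)^-1)) ?invr_ge0 ?(ltW (ku u))//.
rewrite ler_piMl ?invr_ge0 ?(ltW (ku u))// normrM normfV (gtr0_norm (cu u)).
have c21 : 0 <= 2 * c - 1 by move: c1; lra.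
rewrite ler_pdivrMr// mul1r normrM (ger0_norm c21).
have h : 2 * c * `|u| <= c ^+ 2 + u ^+ 2.
  rewrite -(real_normK (num_real u)) -subr_ge0.
  by rewrite (_ : _ - _ = (c - `|u|) ^+ 2) ?sqr_ge0//; ring.
rewrite (le_trans _ h)// ler_wpM2r//; lra.
Qed.

(** The real part of [e^(i u x) / (z (z - 1))] at [z = c + i u]. *)
Definition trig_hat (x u : R) : R := cos (u * x) * chat c u + sin (u * x) * shat c u.

Lemma trig_hat_bound (x u : R) : `|trig_hat x u| <= 2 * (k ^+ 2 + u ^+ 2)^-1.
Proof.
rewrite (le_trans (ler_normD _ _))// !normrM mulrDl mul1r lerD//.
  by rewrite (le_trans _ (chat_bound u))// ler_piMl ?cos_max.
by rewrite (le_trans _ (shat_bound u))// ler_piMl ?sin_max.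
Qed.

Let cont_rat (m : R -> R) (a : R) : 0 < a -> continuous m ->
  continuous (fun u : R => m u / (a ^+ 2 + u ^+ 2)).
Proof.
move=> a0 cm u; apply: cvgM; first exact: cm.
apply: cvgV; first by rewrite gt_eqF// ltr_wpDr ?sqr_ge0// exprn_gt0.
by apply: cvgD; [exact: cvg_cst|exact: exprn_continuous].
Qed.

Lemma continuous_chat : continuous (chat c).
Proof.
move=> u; apply: cvgB; first by apply: (@cont_rat (cst k) k k0) => x; exact: cvg_cst.
by apply: (@cont_rat (cst c) c c0) => x; exact: cvg_cst.
Qed.

Lemma continuous_shat : continuous (shat c).
Proof.
move=> u; apply: cvgB; first by apply: (@cont_rat id k k0) => x; exact: cvg_id.
by apply: (@cont_rat id c c0) => x; exact: cvg_id.
Qed.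

Lemma continuous_trig_hat (x : R) : continuous (trig_hat x).
Proof.
have h : continuous (fun u : R => u * x) by move=> u; apply: cvgM; [exact: cvg_id|exact: cvg_cst].
have hc : continuous (fun u : R => cos (u * x)).
  by move=> u; apply: (@continuous_comp R R R (fun u : R => u * x) cos); [exact: h|exact: continuous_cos].
have hs : continuous (fun u : R => sin (u * x)).
  by move=> u; apply: (@continuous_comp R R R (fun u : R => u * x) sin); [exact: h|exact: continuous_sin].
rewrite /trig_hat => u; apply: cvgD; apply: cvgM.
- exact: hc.
- exact: continuous_chat.
- exact: hs.
- exact: continuous_shat.
Qed.

Lemma chatN (u : R) : chat c (- u) = chat c u.
Proof. by rewrite /chat !sqrrN. Qed.

Lemma shatN (u : R) : shat c (- u) = - shat c u.
Proof. by rewrite /shat !sqrrN !mulNr opprB addrC opprK. Qed.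


(** The damping is the one that [fourier_cauchy] produces; at [e = 0] this is the inversion integral
    itself, absolutely convergent by [trig_hat_bound]. *)
Definition damped_hat (e x : R) : R :=
  \int[mu]_(u in D0) (expR (- (e * u)) * trig_hat x u).

Let bound : R -> R := fun u => 2 * (k ^+ 2 + u ^+ 2)^-1.

Let ibound : mu.-integrable D0 (EFin \o bound).
Proof.
rewrite (_ : _ \o _ = fun u => (2%:E * ((k ^+ 2 + u ^+ 2)^-1)%:E)%E)//.
by apply: integrableZl; [exact: measurable_itv0y|exact: integrable_lorentz].
Qed.

Let continuous_expRN (e : R) : continuous (fun u : R => expR (- (e * u))).
Proof.
move=> u; apply: (@continuous_comp _ _ _ (fun u => - (e * u)) expR); last exact: continuous_expR.
by apply: cvgN; exact: mulrl_continuous.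
Qed.

Let mdamped (e x : R) : measurable_fun D0 (fun u : RT => expR (- (e * u)) * trig_hat x u).
Proof.
apply: measurable_funTS; apply: continuous_measurable_fun => u.
by apply: cvgM; [exact: continuous_expRN|exact: continuous_trig_hat].
Qed.

Let damped_bound (e x u : R) : 0 <= e -> D0 u ->
  `|expR (- (e * u)) * trig_hat x u| <= bound u.
Proof.
rewrite /= in_itv/= andbT => e0 u0; rewrite normrM (ger0_norm (expR_ge0 _)).
rewrite (le_trans _ (trig_hat_bound x u))// ler_piMl//.
by rewrite -expR0 ler_expR oppr_le0 mulr_ge0.
Qed.

Let idamped (e x : R) : 0 <= e ->
  mu.-integrable D0 (EFin \o (fun u => expR (- (e * u)) * trig_hat x u)).
Proof.
move=> e0; apply: (@integrable_le R _ RT mu D0 (fun u => expR (- (e * u)) * trig_hat x u) bound).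
- exact: measurable_itv0y.
- exact: mdamped.
- by move=> u Du; exact: damped_bound.
- exact: ibound.
Qed.

Lemma continuous_damped_hat (e : R) : 0 <= e -> continuous (damped_hat e).
Proof.
move=> e0 x.
pose f (x u : R) := expR (- (e * u)) * trig_hat x u.
have xI : x \in (`]x - 1, x + 1[%classic : set R).
  by rewrite inE/= in_itv/=; apply/andP; split; lra.
apply: (@continuity_under_integral R _ RT mu f D0 measurable_itv0y (x - 1) (x + 1) _ _ bound _ _ x xI).
- by move=> y _; exact: idamped.
- apply: aeW => u Du y _; rewrite /f /trig_hat.
  have h : continuous (fun y : R => u * y) by exact: mulrl_continuous.
  have hc : continuous (fun y : R => cos (u * y)).
    by move=> z; apply: (@continuous_comp R R R (fun y : R => u * y) cos); [exact: h|exact: continuous_cos].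
  have hs : continuous (fun y : R => sin (u * y)).
    by move=> z; apply: (@continuous_comp R R R (fun y : R => u * y) sin); [exact: h|exact: continuous_sin].
  apply: cvgM; first exact: cvg_cst.
  apply: cvgD; (apply: cvgM; last exact: cvg_cst); [exact: hc|exact: hs].
- exact: ibound.
- by move=> y _; apply: aeW => u Du; exact: damped_bound.
Qed.

Lemma damped_hat_bound (e x : R) : 0 <= e ->
  `|damped_hat e x| <= \int[mu]_(u in D0) bound u.
Proof.
move=> e0; rewrite (le_trans (@le_normr_Rintegral _ RT R mu _ _ measurable_itv0y (idamped x e0)))//.
apply: le_Rintegral => //.
- have := integrable_abse (idamped x e0).
  by apply: eq_integrable.
- by move=> u Du; exact: damped_bound.
Qed.

Lemma damped_hat_cvg (x : R) :
  damped_hat (N n)^-1 x @[n --> \oo] --> damped_hat 0 x.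
Proof.
apply: (@Rdominated_cvg _ RT _ mu D0 (fun n u => expR (- ((N n)^-1 * u)) * trig_hat x u)
  (fun u => expR (- (0 * u)) * trig_hat x u) bound).
- exact: measurable_itv0y.
- by move=> n; exact: mdamped.
- exact: mdamped.
- apply: aeW => u Du; apply: cvgM; last exact: cvg_cst.
  apply: (cvg_comp (fun n => - ((N n)^-1 * u)) expR); last exact: continuous_expR.
  by apply: cvgN; apply: cvgM; [exact: cvg_harmonic|exact: cvg_cst].
- exact: ibound.
- by move=> n u Du; apply: damped_bound.
Qed.

(* Equal to [expR (- (c * x)) * Num.max (expR x - 1) 0]. *)
Definition call_tilt (x : R) : R := Num.max (expR (- (k * x)) - expR (- (c * x))) 0.

Lemma call_tilt_ge0 (x : R) : 0 <= call_tilt x.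
Proof. by rewrite /call_tilt le_max lexx orbT. Qed.

Lemma continuous_call_tilt : continuous call_tilt.
Proof.
have h : continuous (fun x : R => expR (- (k * x)) - expR (- (c * x))).
  by move=> x; apply: cvgB; exact: continuous_expRN.
rewrite (_ : call_tilt = fun x => (expR (- (k * x)) - expR (- (c * x)) +
  `|expR (- (k * x)) - expR (- (c * x))|) / 2).
  move=> x; apply: cvgM; last exact: cvg_cst.
  by apply: cvgD; [exact: h|apply: cvg_norm; exact: h].
by apply/funext => x; rewrite /call_tilt maxr_absE addr0 subr0.
Qed.

Lemma call_tilt_pos (x : R) : 0 <= x -> call_tilt x = expR (- (k * x)) - expR (- (c * x)).
Proof.
move=> x0; apply/max_idPl; rewrite subr_ge0 ler_expR lerN2 ler_wpM2r//.
by rewrite /k; lra.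
Qed.

Lemma call_tilt_neg (x : R) : x <= 0 -> call_tilt x = 0.
Proof.
move=> x0; apply/max_idPr; rewrite subr_le0 ler_expR lerN2 ler_wnM2r//.
by rewrite /k; lra.
Qed.

Lemma call_tilt_patch (g : R -> R) :
  (fun x => g x * call_tilt x) =
  ((fun x => g x * (expR (- (k * x)) - expR (- (c * x)))) \_ D0).
Proof.
apply/funext => x; rewrite patchE; case: ifPn => [|].
  by rewrite inE/= in_itv/= andbT => x0; rewrite call_tilt_pos.
rewrite notin_setE/= in_itv/= andbT => /negP; rewrite -ltNge => x0.
by rewrite call_tilt_neg ?mulr0// ltW.
Qed.

Lemma call_tilt_fourier (x u : R) :
  mu.-integrable setT (fun y => (cos (u * (x - y)) * call_tilt y)%:E) /\ \int[mu]_y (cos (u * (x - y)) * call_tilt y) = trig_hat x u.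
Proof.
have cp := call_tilt_patch (fun y => cos (u * (x - y))).
have E (y : R) : cos (u * (x - y)) * (expR (- (k * y)) - expR (- (c * y))) =
    damped_trig (cos (u * x)) (sin (u * x)) k u y -
    damped_trig (cos (u * x)) (sin (u * x)) c u y.
  by rewrite /damped_trig (mulrBr u) cosB; ring.
have i1 := @integrable_damped_trig1 R (cos (u * x)) (sin (u * x)) k u k0.
have i2 := @integrable_damped_trig1 R (cos (u * x)) (sin (u * x)) c u c0.
split.
  rewrite (_ : (fun _ => _) = EFin \o (fun y => cos (u * (x - y)) * call_tilt y))//.
  rewrite cp; apply: integrable_patch; first exact: measurable_itv0y.
  rewrite (_ : _ \o _ = fun y => ((damped_trig (cos (u * x)) (sin (u * x)) k u y)%:E -
    (damped_trig (cos (u * x)) (sin (u * x)) c u y)%:E)%E).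
    by apply: integrableB => //; exact: measurable_itv0y.
  by apply/funext => y /=; rewrite E.
rewrite cp -Rintegral_mkcond; under eq_Rintegral do rewrite E.
rewrite (@RintegralB _ RT R mu _ _ _ measurable_itv0y i1 i2) !laplace_trig//.
by rewrite /trig_hat /chat /shat -/k; ring.
Qed.


Lemma measurable_call_tilt : measurable_fun setT (call_tilt : RT -> R).
Proof. by apply: continuous_measurable_fun; exact: continuous_call_tilt. Qed.

(* Both sides are continuous, so it suffices to compare their integrals over
   intervals, which are the limits of the smoothed inversion formula for the
   probability density proportional to [call_tilt]. *)
Lemma call_tilt_inversion (x : R) : damped_hat 0 x = pi * call_tilt x.
Proof.
have [ic e0] := call_tilt_fourier 0 0.
have h0 : trig_hat 0 0 = (c * k)^-1.
  rewrite /trig_hat mul0r cos0 sin0 /chat /shat -/k /k !expr0n/= !addr0.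
  by field; rewrite !gt_eqF//; exact: k0.
have ck0 : 0 < c * k by rewrite mulr_gt0.
(* [c * k] normalizes: the mass of [call_tilt] is [1 / (c - 1) - 1 / c = 1 / (c * k)]. *)
pose w (y : RT) : R := c * k * call_tilt y.
have w0 y : 0 <= w y by rewrite mulr_ge0 ?call_tilt_ge0// ltW.
have mw : measurable_fun setT w.
  by apply: measurable_funM => //; exact: measurable_call_tilt.
have wE (y : R) : (w y)%:E = ((c * k)%:E * (cos (0 * (0 - y)) * call_tilt y)%:E)%E.
  by rewrite mul0r cos0 mul1r.
have w1 : (\int[mu]_y (w y)%:E = 1)%E.
  under eq_integral do rewrite wE.
  rewrite integralZl// -[X in (_ * X)%E]fineK; last exact: integrable_fin_num.
  by rewrite -/(Rintegral _ _ _) e0 h0 -EFinM divff// gt_eqF.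
have [P PE] := @density_probability _ RT R mu w mw w0 w1.
have PEk := @integral_density _ RT R mu w mw w0 P _ PE.
have char (u y : R) : \int[P]_z cos (u * (y - z)) = c * k * trig_hat y u.
  have [icu eu] := call_tilt_fourier y u.
  have E z : (cos (u * (y - z)) * w z)%:E = ((c * k)%:E * (cos (u * (y - z)) * call_tilt z)%:E)%E.
    by rewrite -EFinM mulrCA.
  have mk : measurable_fun setT (fun z : RT => cos (u * (y - z))).
    apply: (measurableT_comp measurable_cosT); apply: measurable_funM => //.
    exact: measurable_funB.
  rewrite /Rintegral (PEk _ mk).
  under eq_integral do rewrite E.
  rewrite integralZl// -[X in (_ * X)%E]fineK; last exact: integrable_fin_num.
  by rewrite -/(Rintegral _ _ _) eu.
have smoothE (e y : R) : 0 < e -> cauchy_smooth P e y = c * k * damped_hat e y.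
  move=> e_gt0; rewrite fourier_cauchy// /damped_hat.
  rewrite -(@RintegralZl _ _ _ mu _ _ _ measurable_itv0y (idamped y (ltW e_gt0))).
  by apply: eq_Rintegral => u _; rewrite char mulrCA.
(* A law with a density has no atoms, so the limit on the fixed interval [[a, b]] applies. *)
have P1 (a : R) : P [set a] = 0%E.
  by rewrite PE// integral_set1.
pose f y := damped_hat 0 y - pi * call_tilt y.
have cf : continuous f.
  move=> y; apply: cvgB; first exact: continuous_damped_hat.
  by apply: cvgM; [exact: cvg_cst|exact: continuous_call_tilt].
have citv (g : R -> R) a b : continuous g -> mu.-integrable `[a, b] (EFin \o g).
  move=> cg; apply: continuous_compact_integrable; first exact: segment_compact.
  exact: continuous_subspaceT.
suff : forall y, f y = 0 by move=> /(_ x)/eqP; rewrite subr_eq0 => /eqP.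
apply: continuous_itv_integral0 => // a b ab.
have mab : measurable (`[a, b]%classic : set RT) by exact: measurable_itv.
rewrite /f RintegralB//; last 2 first.
- by apply: citv; exact: continuous_damped_hat.
- by apply: citv => y; apply: cvgM; [exact: cvg_cst|exact: continuous_call_tilt].
rewrite RintegralZl//; last by apply: citv; exact: continuous_call_tilt.
apply/eqP; rewrite subr_eq0; apply/eqP.
have lim1 : \int[mu]_(y in `[a, b]) damped_hat (N n)^-1 y @[n --> \oo] -->
    \int[mu]_(y in `[a, b]) damped_hat 0 y.
  apply: (@Rdominated_cvg _ RT _ mu _ _ _ (cst (\int[mu]_(u in D0) bound u))) => //.
  - move=> n; apply: measurable_funTS; apply: continuous_measurable_fun.
    by apply: continuous_damped_hat; rewrite invr_ge0.
  - apply: measurable_funTS; apply: continuous_measurable_fun.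
    exact: continuous_damped_hat.
  - by apply: aeW => y _; exact: damped_hat_cvg.
  - by apply: citv => y; exact: cvg_cst.
  - by move=> n y _; apply: damped_hat_bound; rewrite invr_ge0.
have lim2 := cauchy_smooth_cvg_atomless ab (P1 a) (P1 b).
(* The sequence of [lim2] again, now seen through [smoothE]; equating the two limits compares the
   integrals of [damped_hat 0] and [pi * call_tilt]. *)
have lim3 : \int[mu]_(y in `[a, b]) cauchy_smooth P (N n)^-1 y @[n --> \oo] -->
    c * k * \int[mu]_(y in `[a, b]) damped_hat 0 y.
  rewrite (_ : (fun n => _) = fun n => c * k *
      \int[mu]_(y in `[a, b]) damped_hat (N n)^-1 y).
    by apply: cvgM; [exact: cvg_cst|exact: lim1].
  apply/funext => n; rewrite -RintegralZl//.
    by apply: eq_Rintegral => y _; rewrite smoothE// invr_gt0 ltr0n.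
  by apply: citv; apply: continuous_damped_hat; rewrite invr_ge0.
have := cvg_unique _ lim2 lim3 => /(_ (@norm_hausdorff _ _)) E.
have ckn : c * k != 0 by rewrite gt_eqF.
apply: (mulfI ckn); rewrite -E mulrCA; congr (_ * _).
rewrite PE; last exact: measurable_itv.
rewrite integral_itv_obnd_cbnd; last first.
  by apply/measurable_EFinP; exact: measurable_funTS.
rewrite -RintegralZl//.
by apply: citv; exact: continuous_call_tilt.
Qed.

End fixed.
End payoff.

(** * Whole-line inversion and integration against a tilted law *)

Section pricing.
Context {R : realType}.
Local Notation mu := (@lebesgue_measure R).
Local Notation RT := (measurableTypeR R).
Local Notation D0 := (`[0, +oo[%classic : set R).

Section whole_line.
Variable c : R.
Hypothesis c1 : 1 < c.
Let k0 : 0 < c - 1. Proof. by rewrite subr_gt0. Qed.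

(** The real part of [e^(i (u x + kap)) / (z (z - 1))] at [z = c + i u]; [kap = - pi / 2] gives the
    imaginary part of the same expression without [kap]. *)
Definition phase_hat (kap x u : R) : R :=
  cos (u * x + kap) * chat c u + sin (u * x + kap) * shat c u.

Lemma phase_hat_bound (kap x u : R) :
  `|phase_hat kap x u| <= 2 * ((c - 1) ^+ 2 + u ^+ 2)^-1.
Proof.
rewrite (le_trans (ler_normD _ _))// !normrM mulrDl mul1r lerD//.
  by rewrite (le_trans _ (chat_bound c1 u))// ler_piMl ?cos_max.
by rewrite (le_trans _ (shat_bound c1 u))// ler_piMl ?sin_max.
Qed.

Lemma measurable_chat : measurable_fun setT (chat c : RT -> R).
Proof. by apply: continuous_measurable_fun; exact: continuous_chat. Qed.

Lemma measurable_shat : measurable_fun setT (shat c : RT -> R).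
Proof. by apply: continuous_measurable_fun; exact: continuous_shat. Qed.

Lemma measurable_sinT : measurable_fun setT (@sin R).
Proof. by apply: continuous_measurable_fun; exact: continuous_sin. Qed.

Lemma measurable_phase_hat d (T : measurableType d) (kap : R) (x u : T -> RT) :
  measurable_fun setT x -> measurable_fun setT u ->
  measurable_fun setT (fun t => phase_hat kap (x t) (u t)).
Proof.
move=> mx mu'.
have m : measurable_fun setT (fun t => u t * x t + kap).
  by apply: measurable_funD => //; exact: measurable_funM.
by apply: measurable_funD; apply: measurable_funM;
  [exact: (measurableT_comp measurable_cosT)|exact: (measurableT_comp measurable_chat)
  |exact: (measurableT_comp measurable_sinT)|exact: (measurableT_comp measurable_shat)].
Qed.

Lemma integrable_lorentz_line :
  mu.-integrable setT (fun u => (2 * ((c - 1) ^+ 2 + u ^+ 2)^-1)%:E).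
Proof.
have h : mu.-integrable D0 (EFin \o (fun u : R => 2 * ((c - 1) ^+ 2 + u ^+ 2)^-1)).
  rewrite (_ : _ \o _ = fun u => (2%:E * (((c - 1) ^+ 2 + u ^+ 2)^-1)%:E)%E)//.
  by apply: integrableZl; [exact: measurable_itv0y|exact: integrable_lorentz].
have mf : measurable_fun setT (fun u : RT => 2 * ((c - 1) ^+ 2 + u ^+ 2)^-1).
  apply: measurable_funM => //; apply: continuous_measurable_fun => x.
  apply: cvgV; first by rewrite gt_eqF// ltr_wpDr ?sqr_ge0// exprn_gt0.
  by apply: cvgD; [exact: cvg_cst|exact: exprn_continuous].
have h2 : mu.-integrable D0 (fun u : R => (2 * ((c - 1) ^+ 2 + (- u) ^+ 2)^-1)%:E).
  by apply: eq_integrable h => // u _ /=; rewrite sqrrN.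
by have [] := integral_reflection mf h h2.
Qed.

Lemma integrable_phase_hat (kap x : R) :
  mu.-integrable setT (fun u => (phase_hat kap x u)%:E).
Proof.
apply: (@integrable_le R _ RT mu setT (phase_hat kap x)
  (fun u => 2 * ((c - 1) ^+ 2 + u ^+ 2)^-1)) => //.
- exact: measurable_phase_hat.
- by move=> u _; exact: phase_hat_bound.
- exact: integrable_lorentz_line.
Qed.

(** Since [chat] is even and [shat] odd in [u], the values at [u] and [- u] add up to
    [2 * cos kap * trig_hat]. At [kap = - pi / 2] they cancel: the imaginary part is odd. *)
Lemma phase_hat_line (kap x : R) :
  \int[mu]_u phase_hat kap x u = 2 * pi * cos kap * call_tilt c x.
Proof.
have mf : measurable_fun setT (phase_hat kap x : RT -> R) by exact: measurable_phase_hat.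
have i1 : mu.-integrable D0 (EFin \o phase_hat kap x).
  by apply: integrableS (integrable_phase_hat kap x) => //; exact: measurable_itv0y.
have i2 : mu.-integrable D0 (fun u => (phase_hat kap x (- u))%:E).
  apply: (@integrable_le R _ RT mu D0 (fun u => phase_hat kap x (- u))
    (fun u => 2 * ((c - 1) ^+ 2 + u ^+ 2)^-1)).
  - exact: measurable_itv0y.
  - by apply: measurable_funTS; apply: measurable_phase_hat => //; exact: oppr_measurable.
  - by move=> u _; rewrite (le_trans (phase_hat_bound _ _ _))// sqrrN.
  - by apply: integrableS integrable_lorentz_line => //; exact: measurable_itv0y.
have [_ ->] := integral_reflection mf i1 i2.
rewrite -(@RintegralD _ RT R mu _ _ _ measurable_itv0y i1 i2).
have i0 : mu.-integrable D0 (EFin \o trig_hat c x).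
  apply: eq_integrable (@integrableS _ RT R mu setT D0 _ _ _ _ (integrable_phase_hat 0 x)) => //.
  - by move=> u _ /=; rewrite /phase_hat addr0.
rewrite (_ : 2 * pi * cos kap * call_tilt c x = 2 * cos kap * (pi * call_tilt c x)); last by ring.
rewrite -(call_tilt_inversion c1) /damped_hat.
under [in RHS]eq_Rintegral do rewrite mul0r oppr0 expR0 mul1r.
rewrite -(@RintegralZl _ RT R mu _ _ _ measurable_itv0y i0).
apply: eq_Rintegral => u _; rewrite /phase_hat /trig_hat chatN shatN !mulNr.
rewrite !cosD !sinD cosN sinN; ring.
Qed.

Section parseval.
Variables (nu : probability RT R) (h l : R) (rho phi : R -> R).
Hypothesis inu : nu.-integrable setT (fun y => (expR ((h + c) * y))%:E).
Hypothesis nuE : forall u kap : R,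
  \int[nu]_y (expR ((h + c) * y) * cos (u * y + kap)) = rho u * cos (phi u + kap).

Let mexp : measurable_fun setT (fun y : RT => expR ((h + c) * y)).
Proof. by apply: (measurableT_comp (@measurable_expR R)); exact: measurable_funM. Qed.

Let icos (u kap : R) : nu.-integrable setT
  (fun y => (expR ((h + c) * y) * cos (u * y + kap))%:E).
Proof.
apply: (@integrable_le R _ RT nu setT (fun y => expR ((h + c) * y) * cos (u * y + kap))
   (fun y => expR ((h + c) * y))) => //.
- apply: measurable_funM => //; apply: (measurableT_comp measurable_cosT).
  by apply: measurable_funD => //; exact: measurable_funM.
- by move=> y _; rewrite normrM ger0_norm ?expR_ge0// ler_piMr ?expR_ge0 ?cos_max.
Qed.

Lemma integrable_call_tilt :
  nu.-integrable setT (fun y => (expR ((h + c) * y) * call_tilt c (y + l))%:E).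
Proof.
(* A bound on [call_tilt] read off from its inversion integral at phase 0, the integrand being
   replaced by its majorant. *)
pose M := (2 * pi)^-1 * \int[mu]_u (2 * ((c - 1) ^+ 2 + u ^+ 2)^-1).
apply: (@integrable_le R _ RT nu setT (fun y => expR ((h + c) * y) * call_tilt c (y + l))
  (fun y => M * expR ((h + c) * y))) => //.
- apply: measurable_funM => //.
  by apply: (measurableT_comp (measurable_call_tilt c)); exact: measurable_funD.
- move=> y _; rewrite ger0_norm; last first.
    by rewrite mulr_ge0 ?expR_ge0// call_tilt_ge0.
  rewrite mulrC ler_wpM2r ?expR_ge0//.
  have pi2 : 0 < 2 * pi :> R by rewrite mulr_gt0// pi_gt0.
  rewrite /M ler_pdivlMl//.
  have := phase_hat_line 0 (y + l); rewrite cos0 mulr1 => <-.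
  apply: le_Rintegral => //; [exact: integrable_phase_hat|exact: integrable_lorentz_line|].
  by move=> u _; rewrite (le_trans (ler_norm _))// phase_hat_bound.
- rewrite (_ : _ \o _ = fun y => (M%:E * (expR ((h + c) * y))%:E)%E)//.
  exact: integrableZl.
Qed.

(** Inserting the inversion formula for [call_tilt] and integrating first in [y] replaces
    [e^(i u y)] by the transform of [nu], of modulus [rho] and phase [phi]; integrating first in [u]
    gives back [call_tilt]. *)
Lemma call_parseval (kap : R) :
  mu.-integrable setT (fun u => (rho u *
    (cos (u * l + phi u + kap) * chat c u + sin (u * l + phi u + kap) * shat c u))%:E) /\
  \int[mu]_u (rho u *
    (cos (u * l + phi u + kap) * chat c u + sin (u * l + phi u + kap) * shat c u)) =
  2 * pi * cos kap * \int[nu]_y (expR ((h + c) * y) * call_tilt c (y + l)).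
Proof.
pose H (z : RT * RT) : R := expR ((h + c) * z.2) * phase_hat kap (z.2 + l) z.1.
have mH : measurable_fun setT H.
  apply: measurable_funM; first exact: (measurableT_comp mexp).
  by apply: measurable_phase_hat => //; exact: measurable_funD.
have Hb (u y : RT) : `|H (u, y)| <= 2 * ((c - 1) ^+ 2 + u ^+ 2)^-1 * expR ((h + c) * y).
  rewrite /H /= normrM ger0_norm ?expR_ge0// mulrC ler_wpM2r ?expR_ge0//.
  exact: phase_hat_bound.
have F := Rfubini mH integrable_lorentz_line inu Hb.
have I := integrable_Rintegral mH integrable_lorentz_line inu Hb.
have E (u : R) : \int[nu]_y H (u, y) = rho u *
    (cos (u * l + phi u + kap) * chat c u + sin (u * l + phi u + kap) * shat c u).
  rewrite /H /=.
  (* The sine is written as a cosine delayed by [pi / 2], so that [nuE] handles both terms. *)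
  have e (y : R) : expR ((h + c) * y) * phase_hat kap (y + l) u =
      chat c u * (expR ((h + c) * y) * cos (u * y + (u * l + kap))) +
      shat c u * (expR ((h + c) * y) * cos (u * y + (u * l + kap - pi / 2))).
    rewrite /phase_hat (_ : u * y + (u * l + kap - pi / 2) = (u * (y + l) + kap) - pi / 2); last by ring.
    rewrite (_ : u * y + (u * l + kap) = u * (y + l) + kap); last by ring.
    by rewrite cosB cos_pihalf sin_pihalf mulr0 add0r mulr1; ring.
  under eq_Rintegral do rewrite e.
  have iZ (a k : R) : nu.-integrable setT
      (fun y => (a * (expR ((h + c) * y) * cos (u * y + k)))%:E).
    rewrite (_ : (fun _ => _) = fun y => (a%:E * (expR ((h + c) * y) * cos (u * y + k))%:E)%E)//.
    exact: integrableZl.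
  rewrite (@RintegralD _ RT R nu _ _ _ measurableT (iZ _ _) (iZ _ _)).
  rewrite !(@RintegralZl _ RT R nu _ _ _ measurableT (icos _ _)) !nuE.
  rewrite (_ : phi u + (u * l + kap - pi / 2) = (u * l + phi u + kap) - pi / 2); last by ring.
  rewrite (_ : phi u + (u * l + kap) = u * l + phi u + kap); last by ring.
  by rewrite cosB cos_pihalf sin_pihalf mulr0 add0r mulr1; ring.
split.
  by apply: eq_integrable I => // u _; rewrite E.
under eq_Rintegral do rewrite -E.
rewrite F.
rewrite -(@RintegralZl _ RT R nu _ _ _ measurableT integrable_call_tilt).
apply: eq_Rintegral => y _; rewrite /H /=.
rewrite RintegralZl//; last exact: integrable_phase_hat.
by rewrite phase_hat_line; ring.
Qed.

End parseval.
End whole_line.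
End pricing.

(** * The Variance-Gamma law *)

Section vg_law.
Context {R : realType}.
Local Notation mu := (@lebesgue_measure R).
Local Notation RT := (measurableTypeR R).

(* [vg_modulus] and [vg_phase] are the modulus and an argument of
   [e^(m z) ((1 - z / a1) (1 + z / a2))^(- p)] at [z = c + i u]. *)
Definition vg_modulus (p m a1 a2 c u : R) : R :=
  expR (c * m
    - p * (2^-1 * (ln ((a1 - c) ^+ 2 + u ^+ 2) - ln (a1 ^+ 2)))
    - p * (2^-1 * (ln ((a2 + c) ^+ 2 + u ^+ 2) - ln (a2 ^+ 2)))).

Definition vg_phase (p m a1 a2 c u : R) : R :=
  u * m + p * atan (u / (a1 - c)) - p * atan (u / (a2 + c)).

Lemma vg_law (p m a1 a2 : R) : 0 < p -> 0 < a1 -> 0 < a2 ->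
  exists nu : probability RT R, forall c u : R, - a2 < c < a1 ->
    nu.-integrable setT (fun y => (expR (c * y))%:E) /\
    forall k, \int[nu]_y (expR (c * y) * cos (u * y + k)) =
      vg_modulus p m a1 a2 c u * cos (vg_phase p m a1 a2 c u + k).
Proof.
move=> p0 a10 a20; pose q := p^-1.
have q0 : 0 < q by rewrite invr_gt0.
have qp : q^-1 = p by rewrite invrK.
have [P1 h1] := gamma_law q0 a10; have [P2 h2] := gamma_law q0 a20.
rewrite qp in h1 h2.
pose X (z : RT * RT) : RT := m + z.1 `^ q - z.2 `^ q.
have mX : measurable_fun setT X.
  apply: measurable_funB; first apply: measurable_funD => //.
    exact: (measurableT_comp (@measurable_powR R q)).
  exact: (measurableT_comp (@measurable_powR R q)).
pose Q := (P1 \x P2)%E : probability (RT * RT)%type R.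
pose X' : {RV Q >-> RT} := HB.pack X (isMeasurableFun.Build _ _ _ _ X mX).
exists (distribution Q X') => c u /andP[c1 c2].
have a1c : 0 < a1 - c by rewrite subr_gt0.
have a2c : 0 < a2 - (- c) by rewrite opprK; lra.
(* The second gamma variable is subtracted, so its transform is taken at [- (c + i u)]. *)
have [i1 e1] := h1 c u a1c; have [i2 e2] := h2 (- c) (- u) a2c.
pose h k (z : RT * RT) : R := expR (c * X z) * cos (u * X z + k).
have mh k : measurable_fun setT (h k).
  apply: measurable_funM.
    apply: (measurableT_comp (@measurable_expR R)).
    by apply: measurable_funM.
  apply: (measurableT_comp measurable_cosT).
  by apply: measurable_funD => //; apply: measurable_funM.
pose b (x : RT) := expR (c * m) * expR (c * x `^ q).
have ib : P1.-integrable setT (EFin \o b).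
  rewrite (_ : _ \o _ = fun x => ((expR (c * m))%:E * (expR (c * x `^ q))%:E)%E)//.
  exact: integrableZl.
pose b2 (y : RT) := expR (- c * y `^ q).
(* For fixed [x] the first variable only shifts the phase of the cosine; the two transforms can then
   be applied one after the other. *)
have hE k x y : h k (x, y) = b x * (b2 y * cos (- u * y `^ q + (u * m + u * x `^ q + k))).
  rewrite /h /b /b2 /X /= mulrBr mulrDr !expRD mulNr -!mulrA.
  by congr (_ * (_ * (_ * cos _))); ring.
have hb k (x y : RT) : `|h k (x, y)| <= b x * b2 y.
  have b0 : 0 <= b x by rewrite mulr_ge0 ?expR_ge0.
  rewrite hE normrM (ger0_norm b0) ler_wpM2l// normrM ger0_norm ?expR_ge0//.
  by rewrite ler_piMr ?expR_ge0 ?cos_max.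
have ih k := product_dominated_integrable (mh k) ib i2 (hb k).
have mk k : measurable_fun setT (fun y : RT => (expR (c * y) * cos (u * y + k))%:E).
  apply/measurable_EFinP; apply: measurable_funM.
    apply: (measurableT_comp (@measurable_expR R)).
    by apply: measurable_funM.
  apply: (measurableT_comp measurable_cosT).
  by apply: measurable_funD => //; apply: measurable_funM.
split.
  pose h0 (z : RT * RT) : R := expR (c * X z).
  have mh0 : measurable_fun setT h0.
    by apply: (measurableT_comp (@measurable_expR R)); exact: measurable_funM.
  have hb0 (x y : RT) : `|h0 (x, y)| <= b x * b2 y.
    rewrite /h0 ger0_norm ?expR_ge0// /X /b /b2 /= mulrBr mulrDr !expRD mulNr//.
  have ih0 := product_dominated_integrable mh0 ib i2 hb0.
  have mexp : measurable_fun setT (fun y : RT => (expR (c * y))%:E).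
    apply/measurable_EFinP; apply: (measurableT_comp (@measurable_expR R)).
    exact: measurable_funM.
  by apply: (@integrable_pushforward _ _ _ _ _ X mX Q setT) => //; rewrite preimage_setT.
move=> k; rewrite /Rintegral integral_distribution//=; last exact: ih.
rewrite -/(Rintegral _ _ _) (integral_prod_Rintegral (mh k) ib i2 (hb k)).
have ic (k' : R) : P2.-integrable setT (fun y => (b2 y * cos (- u * y `^ q + k'))%:E).
  apply: (@integrable_le R _ RT P2 setT (fun y => b2 y * cos (- u * y `^ q + k')) b2) => //.
    apply: measurable_funM.
      apply: (measurableT_comp (@measurable_expR R)).
      by apply: measurable_funM => //; exact: measurable_powR.
    apply: (measurableT_comp measurable_cosT).
    by apply: measurable_funD => //; apply: measurable_funM => //; exact: measurable_powR.
  by move=> y _; rewrite normrM ger0_norm ?expR_ge0// ler_piMr ?expR_ge0 ?cos_max.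
under eq_Rintegral => x _.
  under eq_Rintegral do rewrite hE.
  rewrite (RintegralZl _ measurableT (ic _)) e2.
  over.
rewrite opprK mulNr atanN mulrN.
set r2 := expR (- _); set B2 := p * atan (u / (a2 + c)).
have ic1 (k' : R) : P1.-integrable setT (fun x => (expR (c * x `^ q) * cos (u * x `^ q + k'))%:E).
  apply: (@integrable_le R _ RT P1 setT (fun x => expR (c * x `^ q) * cos (u * x `^ q + k'))
    (fun x => expR (c * x `^ q))) => //.
    apply: measurable_funM.
      apply: (measurableT_comp (@measurable_expR R)).
      by apply: measurable_funM => //; exact: measurable_powR.
    apply: (measurableT_comp measurable_cosT).
    by apply: measurable_funD => //; apply: measurable_funM => //; exact: measurable_powR.
  by move=> y _; rewrite normrM ger0_norm ?expR_ge0// ler_piMr ?expR_ge0 ?cos_max.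
transitivity (\int[P1]_x (expR (c * m) * r2 *
    (expR (c * x `^ q) * cos (u * x `^ q + (u * m - B2 + k))))).
  apply: eq_Rintegral => x _; rewrite /b.
  rewrite (_ : - B2 + (u * m + u * x `^ q + k) = u * x `^ q + (u * m - B2 + k)); ring.
rewrite (RintegralZl _ measurableT (ic1 _)) e1 /vg_modulus /vg_phase -/B2 /r2 sqrrN.
rewrite mulrA -!expRD; congr (expR _ * cos _); ring.
Qed.


End vg_law.

(** * Complex form of the Variance-Gamma transform *)

Section vg_base.
Context {R : realType}.

(* [(a1 - c - i u) (a2 + c + i u) / (a1 a2)] *)
Definition vg_base (a1 a2 c u : R) : R[i] :=
  (((a1 - c) * (a2 + c) + u ^+ 2) / (a1 * a2)) +i* (u * (a1 - a2 - 2 * c) / (a1 * a2)).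

Definition vg_logmod (a1 a2 c u : R) : R :=
  2^-1 * (ln ((a1 - c) ^+ 2 + u ^+ 2) - ln (a1 ^+ 2)) +
  2^-1 * (ln ((a2 + c) ^+ 2 + u ^+ 2) - ln (a2 ^+ 2)).

Definition vg_arg (a1 a2 c u : R) : R := atan (u / (a2 + c)) - atan (u / (a1 - c)).

Section base.
Variables a1 a2 c u : R.
Hypotheses (a10 : 0 < a1) (a20 : 0 < a2) (ca : - a2 < c < a1).
Let b1 : 0 < a1 - c. Proof. by case/andP: ca; rewrite subr_gt0. Qed.
Let b2 : 0 < a2 + c. Proof. by case/andP: ca => + _; lra. Qed.

Lemma vg_base_polar : vg_base a1 a2 c u = polar (expR (vg_logmod a1 a2 c u)) (vg_arg a1 a2 c u).
Proof.
have e : vg_base a1 a2 c u = ((a1 - c) +i* (- u)) * ((a2 + c) +i* u) * polar (a1 * a2)^-1 0.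
  rewrite /polar cos0 sin0 mulr1 mulr0; simpc.
  by rewrite /vg_base; congr (_ +i* _); field; rewrite !gt_eqF.
rewrite e (gt0_Re_polar _ b1) (gt0_Re_polar _ b2) !polarM sqrrN.
have ln2 (a : R) : 0 < a -> 2^-1 * ln (a ^+ 2) = ln a.
  by move=> a0; rewrite lnXn// (mulr2n (ln a)); lra.
congr polar; last by rewrite /vg_arg mulNr atanN addr0 addrC.
rewrite -expRD -[(a1 * a2)^-1]lnK ?posrE ?invr_gt0 ?mulr_gt0// -expRD; congr expR.
rewrite lnV ?posrE ?mulr_gt0// lnM ?posrE// -(ln2 _ a10) -(ln2 _ a20) /vg_logmod.
ring.
Qed.

(** Both denominators are positive, so the two arctangents have the same sign and their difference
    stays within a quarter turn. Hence [vg_base] avoids the cut, and its principal logarithm splits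
    into those of its factors. *)
Lemma vg_arg_itv : - (pi / 2) < vg_arg a1 a2 c u < pi / 2.
Proof.
rewrite /vg_arg.
have := atan_gtNpi2 (u / (a2 + c)); have := atan_ltpi2 (u / (a2 + c)).
have := atan_gtNpi2 (u / (a1 - c)); have := atan_ltpi2 (u / (a1 - c)) => h1 h2 h3 h4.
have [u0|u0] := leP 0 u.
  have t1 : 0 <= atan (u / (a2 + c)) by rewrite -(@atan0 R) le_atan// divr_ge0// ltW.
  have t2 : 0 <= atan (u / (a1 - c)) by rewrite -(@atan0 R) le_atan// divr_ge0// ltW.
  by apply/andP; split; lra.
have t1 : atan (u / (a2 + c)) <= 0.
  by rewrite -(@atan0 R) le_atan// mulr_le0_ge0 ?invr_ge0// ltW.
have t2 : atan (u / (a1 - c)) <= 0.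
  by rewrite -(@atan0 R) le_atan// mulr_le0_ge0 ?invr_ge0// ltW.
by apply/andP; split; lra.
Qed.

Lemma clog_vg_base : clog (vg_base a1 a2 c u) = vg_logmod a1 a2 c u +i* vg_arg a1 a2 c u.
Proof. by rewrite vg_base_polar clog_polar ?expR_gt0 ?vg_arg_itv// expRK. Qed.

Lemma cpow_vg_base p :
  cpow (vg_base a1 a2 c u) p = polar (expR (p * vg_logmod a1 a2 c u)) (p * vg_arg a1 a2 c u).
Proof. by rewrite vg_base_polar cpow_polar ?expR_gt0 ?vg_arg_itv// expRK. Qed.

End base.

Lemma vg_modulusE (p m a1 a2 c u : R) :
  vg_modulus p m a1 a2 c u = expR (c * m - p * vg_logmod a1 a2 c u).
Proof. by rewrite /vg_modulus /vg_logmod; congr expR; ring. Qed.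

Lemma vg_phaseE (p m a1 a2 c u : R) :
  vg_phase p m a1 a2 c u = u * m - p * vg_arg a1 a2 c u.
Proof. by rewrite /vg_phase /vg_arg; ring. Qed.

(** The Esscher tilt: dividing the transform at [h + z] by its value at [h] gives the transform at
    [z] for the rates [a1 - h] and [a2 + h]. The drift [m] and the shape [p] do not change. *)
Lemma vg_modulus_shift (p m a1 a2 h c u : R) :
  vg_modulus p m a1 a2 (h + c) u =
  vg_modulus p m a1 a2 h 0 * vg_modulus p m (a1 - h) (a2 + h) c u.
Proof.
rewrite /vg_modulus -expRD opprD !addrA expr0n/= !addr0; congr expR; ring.
Qed.

Lemma vg_phase_shift (p m a1 a2 h c u : R) :
  vg_phase p m a1 a2 (h + c) u = vg_phase p m (a1 - h) (a2 + h) c u.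
Proof. by rewrite /vg_phase opprD !addrA. Qed.

Lemma vg_phase0 (p m a1 a2 c : R) : vg_phase p m a1 a2 c 0 = 0.
Proof. by rewrite /vg_phase !mul0r atan0 !mulr0 addr0 subr0. Qed.

Lemma cexp_cI (x : R) : cexp (cI * x%:C) = cos x +i* sin x.
Proof.
rewrite /cI (_ : _ * x%:C = 0 +i* x); last by simpc; rewrite ?mul0r ?mul1r.
by rewrite cexp_polar expR0 /polar !mul1r.
Qed.

(** The coefficients are [theta = 2 / (s^2 a1 a2)] and [delta = - s^2 (a1 - a2) / 2], the parameters
    expressed by the rates. At [xi = u + i q] the variable [z = i xi] is [- q + i u]. *)
Lemma quadratic_vg_base (s a1 a2 q u : R) : 0 < s -> 0 < a1 -> 0 < a2 ->
  1 + (2^-1 * (2 / (s ^+ 2 * (a1 * a2))) * s ^+ 2)%:C * (u +i* q) ^+ 2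
  - cI * (- s ^+ 2 / 2 * (a1 - a2) * (2 / (s ^+ 2 * (a1 * a2))))%:C * (u +i* q) =
  vg_base a1 a2 (- q) u.
Proof.
move=> s0 a10 a20; rewrite /vg_base /cI expr2; simpc.
by congr (_ +i* _); field; rewrite !gt_eqF.
Qed.

Section roots.
Variables delta sigma theta : R.
Hypotheses (s0 : 0 < sigma) (t0 : 0 < theta).
Let h1 := VG_h1 delta sigma theta.
Let h2 := VG_h2 delta sigma theta.

Lemma VG_roots_mul : h2 * - h1 = 2 / (theta * sigma ^+ 2).
Proof.
rewrite /h1 /h2 /VG_h1 /VG_h2; set x := delta / _; set y := Num.sqrt _.
have y2 : y ^+ 2 = delta ^+ 2 / sigma ^+ 4 + 2 / (theta * sigma ^+ 2).
  rewrite sqr_sqrtr// addr_ge0 ?divr_ge0 ?sqr_ge0 ?exprn_ge0 ?mulr_ge0 ?(ltW s0) ?(ltW t0)//.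
rewrite (_ : _ * _ = y ^+ 2 - x ^+ 2); last by ring.
by rewrite y2 /x; field; rewrite !gt_eqF.
Qed.

Lemma VG_roots_sub : h2 - - h1 = - 2 * delta / sigma ^+ 2.
Proof. by rewrite /h1 /h2 /VG_h1 /VG_h2; ring. Qed.

(** The roots have a negative product and [h1 <= h2], so 0 lies strictly between them and both gamma
    rates are positive. *)
Lemma VG_h2_gt0 : 0 < h2 /\ 0 < - h1.
Proof.
have h21 : h1 <= h2.
  rewrite /h1 /h2 /VG_h1 /VG_h2 lerD2l (@le_trans _ _ 0) ?oppr_le0 ?sqrtr_ge0//.
have m : 0 < h2 * - h1.
  by rewrite VG_roots_mul divr_gt0// mulr_gt0// exprn_gt0.
have [h20|h20] := ltP 0 h2; first by move: m; rewrite pmulr_rgt0.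
move: m; rewrite mulrN oppr_gt0 => m.
have : 0 <= h2 * h1 by rewrite mulr_le0// (le_trans h21).
by rewrite leNgt m.
Qed.

Lemma VG_charfun_base (u : R) :
  1 - cI * (delta * theta * u)%:C + (2^-1 * sigma ^+ 2 * theta * u ^+ 2)%:C =
  vg_base h2 (- h1) 0 u.
Proof.
rewrite /vg_base VG_roots_mul VG_roots_sub subr0 addr0 mulr0 subr0 VG_roots_mul.
rewrite /cI; simpc; congr (_ +i* _); field; rewrite !gt_eqF//.
Qed.

Lemma VG_exponent_base (h q u : R) : h1 < h < h2 ->
  1 + (2^-1 * esscher_theta delta sigma theta h * sigma ^+ 2)%:C * (u +i* q) ^+ 2
  - cI * (esscher_delta delta sigma h * esscher_theta delta sigma theta h)%:C * (u +i* q) =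
  vg_base (h2 - h) (- h1 + h) (- q) u.
Proof.
move=> /andP[h1h hh2].
have A1 : 0 < h2 - h by rewrite subr_gt0.
have A2 : 0 < - h1 + h by rewrite addrC subr_gt0.
have m := VG_roots_mul; have s := VG_roots_sub.
have AA : (h2 - h) * (- h1 + h) = 2 / (theta * sigma ^+ 2) - 2 * delta / sigma ^+ 2 * h - h ^+ 2.
  rewrite (_ : _ * _ = h2 * - h1 + (h2 - - h1) * h - h ^+ 2); last by ring.
  by rewrite m s; ring.
pose D := 1 - 2^-1 * theta * sigma ^+ 2 * h ^+ 2 - delta * theta * h.
have DE : D = 2^-1 * theta * sigma ^+ 2 * ((h2 - h) * (- h1 + h)).
  by rewrite AA /D; field; rewrite !gt_eqF.
have D0 : D != 0 by rewrite DE gt_eqF// !mulr_gt0 ?exprn_gt0.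
have tE : esscher_theta delta sigma theta h = 2 / (sigma ^+ 2 * ((h2 - h) * (- h1 + h))).
  rewrite /esscher_theta -/D DE.
  by field; rewrite !gt_eqF.
have dE : esscher_delta delta sigma h = - (sigma ^+ 2) / 2 * ((h2 - h) - (- h1 + h)).
  rewrite (_ : h2 - h - (- h1 + h) = h2 - - h1 - 2 * h); last by ring.
  by rewrite s /esscher_delta; field; rewrite gt_eqF.
rewrite tE dE; exact: quadratic_vg_base.
Qed.

End roots.

Lemma call_kernel (c u : R) : 1 < c ->
  ((c +i* u) * ((c +i* u) - 1))^-1 = chat c u +i* (- shat c u).
Proof.
move=> c1; have c0 : 0 < c by exact: lt_trans c1.
have k0 : 0 < c - 1 by rewrite subr_gt0.
have cu : c ^+ 2 + u ^+ 2 != 0 by rewrite gt_eqF// ltr_wpDr ?sqr_ge0// exprn_gt0.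
have ku : (c - 1) ^+ 2 + u ^+ 2 != 0 by rewrite gt_eqF// ltr_wpDr ?sqr_ge0// exprn_gt0.
have h : (chat c u +i* (- shat c u)) * ((c +i* u) * ((c +i* u) - 1)) = 1.
  by simpc; rewrite /chat /shat; congr (_ +i* _); field; rewrite cu ku.
have z0 : (c +i* u) * ((c +i* u) - 1) != 0.
  by apply: contra_eq_neq h => ->; rewrite mulr0 eq_sym oner_eq0.
by apply: (mulIf z0); rewrite mulVf// h.
Qed.

End vg_base.

(** * Identification of the increment with the model law *)

Section transfer.
Context {R : realType}.
Local Notation mu := (@lebesgue_measure R).
Local Notation RT := (measurableTypeR R).

Lemma VG_distribution (d : measure_display) (Omega : measurableType d)
    (P : probability Omega R) (X : {RV P >-> RT}) (nu : probability RT R)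
    (delta sigma theta m p : R) : 0 < sigma -> 0 < theta ->
  let a1 := VG_h2 delta sigma theta in
  let a2 := - VG_h1 delta sigma theta in
  (forall u : R, char_fun P X u = cexp (cI * (m * u)%:C) /
      cpow (1 - cI * (delta * theta * u)%:C
              + (2^-1 * sigma ^+ 2 * theta * u ^+ 2)%:C) p) ->
  (forall u k : R, \int[nu]_y cos (u * y + k) =
     vg_modulus p m a1 a2 0 u * cos (vg_phase p m a1 a2 0 u + k)) ->
  forall A, measurable A -> distribution P X A = nu A.
Proof.
move=> s0 t0 a1 a2 hX hnu.
have [a10 a20] := VG_h2_gt0 delta s0 t0.
have ca : - a2 < 0 < a1 by rewrite a10 andbT oppr_lt0.
have charE (u : R) : char_fun P X u =
    polar (vg_modulus p m a1 a2 0 u) (vg_phase p m a1 a2 0 u).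
  rewrite hX VG_charfun_base// cpow_vg_base// cexp_cI.
  rewrite polarV ?gt_eqF ?expR_gt0//.
  rewrite (_ : cos (m * u) +i* sin (m * u) = polar 1 (m * u)); last by rewrite /polar !mul1r.
  rewrite polarM mul1r -expRN vg_modulusE vg_phaseE mul0r add0r.
  by congr polar; rewrite (mulrC m).
have cE (u : R) : char_fun P X u = (\int[P]_w cos (u * X w)) +i* (\int[P]_w sin (u * X w)).
  by congr (_ +i* _); apply: eq_Rintegral => w _; rewrite cexp_cI.
have reE (u : R) : \int[P]_w cos (u * X w) = vg_modulus p m a1 a2 0 u * cos (vg_phase p m a1 a2 0 u).
  by have := charE u; rewrite cE => -[].
have imE (u : R) : \int[P]_w sin (u * X w) = vg_modulus p m a1 a2 0 u * sin (vg_phase p m a1 a2 0 u).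
  by have := charE u; rewrite cE => -[].
apply: law_unique => u x.
have mX : measurable_fun setT (X : Omega -> R) by exact: (measurable_funPT X).
have mc : measurable_fun setT (fun w => cos (u * X w)).
  by apply: (measurableT_comp (@measurable_cosT R)); exact: measurable_funM.
have ms : measurable_fun setT (fun w => sin (u * X w)).
  by apply: (measurableT_comp (@measurable_sinT R)); exact: measurable_funM.
have i1 : P.-integrable setT (EFin \o (cst 1 : Omega -> R)).
  exact: finite_measure_integrable_cst.
have ic (k : R) : P.-integrable setT (fun w => (k * cos (u * X w))%:E).
  apply: (@integrable_le R _ Omega P setT (fun w => k * cos (u * X w)) (cst `|k|)) => //.
  - exact: measurable_funM.
  - by move=> w _; rewrite normrM ler_piMr ?cos_max.
  - exact: finite_measure_integrable_cst.
have is_ (k : R) : P.-integrable setT (fun w => (k * sin (u * X w))%:E).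
  apply: (@integrable_le R _ Omega P setT (fun w => k * sin (u * X w)) (cst `|k|)) => //.
  - exact: measurable_funM.
  - by move=> w _; rewrite normrM ler_piMr ?sin_max.
  - exact: finite_measure_integrable_cst.
have ic1 : P.-integrable setT (fun w => (cos (u * X w))%:E).
  by apply: eq_integrable (ic 1) => // w _; rewrite mul1r.
have is1 : P.-integrable setT (fun w => (sin (u * X w))%:E).
  by apply: eq_integrable (is_ 1) => // w _; rewrite mul1r.
have E w : cos (u * (x - X w)) = cos (u * x) * cos (u * X w) + sin (u * x) * sin (u * X w).
  by rewrite mulrBr cosB.
transitivity (\int[P]_w cos (u * (x - X w))).
  rewrite /Rintegral integral_distribution//.
    apply/measurable_EFinP; apply: (measurableT_comp (@measurable_cosT R)).
    by apply: measurable_funM => //; exact: measurable_funB.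
  rewrite (_ : _ \o _ = fun w => ((cos (u * x) * cos (u * X w))%:E + (sin (u * x) * sin (u * X w))%:E)%E).
    exact: integrableD.
  by apply/funext => w /=; rewrite E.
under eq_Rintegral do rewrite E.
rewrite (@RintegralD _ Omega R P _ _ _ measurableT (ic _) (is_ _)).
rewrite (@RintegralZl _ Omega R P _ _ _ measurableT ic1).
rewrite (@RintegralZl _ Omega R P _ _ _ measurableT is1) reE imE.
(* The translation by [x] in [law_unique] is the phase [- u x] in the transform of [nu]. *)
transitivity (\int[nu]_y cos (u * y + - (u * x))).
  by rewrite hnu cosB; ring.
by apply: eq_Rintegral => y _; rewrite -cosN; congr cos; ring.
Qed.

End transfer.

(** * The pricing formula *)

Theorem theorem4p3 (R : realType) (d : measure_display)
    (Omega : measurableType d) (P : probability Omega R)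
    (Y : R -> {RV P >-> R}) (f : R -> R -> R)
    (r mu delta sigma alpha theta hstar S0 K T t q : R) (w : Omega)
    (sigma_gt0 : 0 < sigma) (alpha_gt0 : 0 < alpha) (theta_gt0 : 0 < theta)
    (Y_VG : VG_process Y mu delta sigma alpha theta)
    (f_density : forall u : R, 0 < u -> is_density (Y u) (f ^~ u))
    (h_wide : 1 < VG_h2 delta sigma theta - VG_h1 delta sigma theta)
    (hstar_esscher : esscher_parameter Y r (VG_h1 delta sigma theta)
                       (VG_h2 delta sigma theta) hstar)
    (S0_gt0 : 0 < S0) (K_gt0 : 0 < K) (t_ge0 : 0 <= t) (t_lt_T : t < T)
    (q_lt : q < -1) (q_strip : hstar - q < VG_h2 delta sigma theta) :
  let tau := T - t in
  let s := asset_price Y S0 t w in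
  let phi := VG_exponent mu (esscher_delta delta sigma hstar) sigma alpha
               (esscher_theta delta sigma theta hstar) in
  [/\ lebesgue_measure.-integrable setT
        (fun y => (call_integrand Y f hstar K s tau y)%:E),
      line_integrable q (call_transform phi r K s tau) &
      (call_price Y f r hstar K s tau)%:C =
        (K / (2 * pi))%:C * line_integral q (call_transform phi r K s tau)].
Proof.
move=> tau s phi.
have tau0 : 0 < tau by rewrite subr_gt0.
have s0 : 0 < s by rewrite mulr_gt0// expR_gt0.
have [a10 a20] := VG_h2_gt0 delta sigma_gt0 theta_gt0.
case: hstar_esscher => /andP[hs1 hs2] _.
set a1 := VG_h2 delta sigma theta in a10 hs2 q_strip h_wide *.
pose a2 := - VG_h1 delta sigma theta; rewrite -/a2 in a20.
have hs1' : - a2 < hstar by rewrite opprK.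
pose c := - q; have c1 : 1 < c by rewrite /c; lra.
pose p := tau * alpha; pose m := tau * mu.
have p0 : 0 < p by rewrite mulr_gt0.
have [nu hnu] := vg_law m p0 a10 a20.
have ca0 : - a2 < 0 < a1 by rewrite a10 andbT oppr_lt0.
have cah : - a2 < hstar < a1 by rewrite hs1'; lra.
(* [q_strip] enters here: the damped and tilted law has a moment of order [hstar + c]. *)
have cahc : - a2 < hstar + c < a1 by rewrite /c; apply/andP; split; lra.
have mYtau : measurable_fun setT (Y tau : Omega -> measurableTypeR R).
  exact: (measurable_funPT (Y tau)).
pose X : {RV P >-> measurableTypeR R} :=
  HB.pack (Y tau : Omega -> measurableTypeR R) (isMeasurableFun.Build _ _ _ _ _ mYtau).
have nuE A : measurable A -> distribution P X A = nu A.
  apply: (@VG_distribution R d Omega P X nu delta sigma theta m p) => //.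
    by move=> u; exact: (Y_VG.2 tau u (ltW tau0)).
  move=> u k; have [_ <-] := hnu 0 u ca0.
  by apply: eq_Rintegral => y _; rewrite mul0r expR0 mul1r.
have [mf f0 fE] := f_density tau tau0.
(* The density is known only through the law it represents; this turns integrals against [f] into
   integrals against [nu]. *)
have densE (k : R -> \bar R) : measurable_fun setT k -> (forall x, 0 <= k x)%E ->
    (\int[lebesgue_measure]_y (k y * (f y tau)%:E) = \int[nu]_y k y)%E.
  move=> mk k0.
  rewrite -(@ge0_integral_density _ (measurableTypeR R) R lebesgue_measure (f ^~ tau) mf f0
    (distribution P X) k fE mk k0).
  by apply: eq_measure_integral => A mA _; exact: nuE.
pose M := vg_modulus p m a1 a2 hstar 0.
have M0 : 0 < M by exact: expR_gt0.
have [ih eh] := hnu hstar 0 cah.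
have mgfE : mgf Y hstar tau = M.
  have := eh 0; rewrite vg_phase0 addr0 cos0 mulr1 -/M => <-.
  rewrite /mgf /Rintegral; congr fine.
  have mexp : measurable_fun setT (fun y : measurableTypeR R => (expR (hstar * y))%:E).
    apply/measurable_EFinP; apply: (measurableT_comp (@measurable_expR R)).
    exact: measurable_funM.
  have e0 (y : measurableTypeR R) : (0 <= (expR (hstar * y))%:E)%E by rewrite lee_fin expR_ge0.
  transitivity (\int[distribution P X]_y (expR (hstar * y))%:E)%E.
    rewrite (@ge0_integral_distribution _ _ _ _ _ P X _ mexp e0).
    by rewrite /mmt_gen_fun unlock; apply: eq_integral => z _ /=; rewrite mulrC.
  transitivity (\int[nu]_y (expR (hstar * y))%:E)%E.
    by apply: eq_measure_integral => A mA _; exact: nuE.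
  by apply: eq_integral => y _; rewrite mul0r addr0 cos0 mulr1.
pose l := ln (s / K).
(* The gamma rates after the Esscher tilt. *)
pose a1' := a1 - hstar; pose a2' := a2 + hstar.
have a1'0 : 0 < a1' by rewrite subr_gt0; case/andP: cah.
have a2'0 : 0 < a2' by rewrite /a2'; lra.
have cc : - a2' < c < a1' by rewrite /a1' /a2'; apply/andP; split; lra.
have [ihc _] := hnu (hstar + c) 0 cahc.
pose rho u := vg_modulus p m a1 a2 (hstar + c) u.
pose ph u := vg_phase p m a1 a2 (hstar + c) u.
have ehc u k : \int[nu]_y (expR ((hstar + c) * y) * cos (u * y + k)) =
    rho u * cos (ph u + k) by have [_] := hnu (hstar + c) u cahc.
have itilt := @integrable_call_tilt R c c1 nu hstar l ihc.
pose I := \int[nu]_y (expR ((hstar + c) * y) * call_tilt c (y + l)).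
have [iRe eRe] := @call_parseval R c c1 nu hstar l rho ph ihc ehc 0.
have [iIm eIm] := @call_parseval R c c1 nu hstar l rho ph ihc ehc (- (pi / 2)).
rewrite cos0 mulr1 -/I in eRe.
rewrite cosN cos_pihalf mulr0 mul0r in eIm.
(* As [s / K = exp l], the payoff is [K] times that of a unit strike at [y + l]. The positive factor
   [exp (c (y + l))] leaves the maximum and splits into a constant and extra tilting by [c]. *)
have payoff y : expR (hstar * y) * Num.max (s * expR y - K) 0 =
    K * expR (c * l) * (expR ((hstar + c) * y) * call_tilt c (y + l)).
  have -> : s * expR y - K = K * expR (c * (y + l)) *
      (expR (- ((c - 1) * (y + l))) - expR (- (c * (y + l)))).
    rewrite -mulrA mulrBr -!expRD subrr expR0.
    rewrite (_ : c * (y + l) - (c - 1) * (y + l) = y + l); last by ring.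
    rewrite expRD /l lnK ?posrE ?divr_gt0//.
    by field; rewrite gt_eqF.
  have kp : 0 <= K * expR (c * (y + l)) by rewrite mulr_ge0 ?expR_ge0 ?ltW.
  rewrite -[X in Num.max _ X](mulr0 (K * expR (c * (y + l)))) -maxr_pMr//.
  rewrite -/(call_tilt c (y + l)) !mulrDr mulrDl !expRD; ring.
pose C := K * expR (c * l) / M.
have C0 : 0 <= C by rewrite !mulr_ge0 ?invr_ge0 ?expR_ge0 ?ltW.
have ciE y : call_integrand Y f hstar K s tau y =
    C * (expR ((hstar + c) * y) * call_tilt c (y + l)) * f y tau.
  rewrite /call_integrand /esscher_density mgfE.
  transitivity (expR (hstar * y) * Num.max (s * expR y - K) 0 / M * f y tau).
    by ring.
  by rewrite payoff /C; ring.
have mtilt : measurable_fun setT (fun y : measurableTypeR R =>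
    C * (expR ((hstar + c) * y) * call_tilt c (y + l))).
  apply: measurable_funM => //; apply: measurable_funM.
    by apply: (measurableT_comp (@measurable_expR R)); exact: measurable_funM.
  by apply: (measurableT_comp (measurable_call_tilt c)); exact: measurable_funD.
have tilt0 y : 0 <= C * (expR ((hstar + c) * y) * call_tilt c (y + l)).
  apply: mulr_ge0 => //.
  by apply: mulr_ge0; [exact: expR_ge0|exact: call_tilt_ge0].
have intE : (\int[lebesgue_measure]_y (call_integrand Y f hstar K s tau y)%:E = (C * I)%:E)%E.
  under eq_integral do rewrite ciE EFinM.
  rewrite (densE (fun y => (C * (expR ((hstar + c) * y) * call_tilt c (y + l)))%:E)).
  - under eq_integral do rewrite EFinM.
    rewrite integralZl// [RHS]EFinM; congr (_ * _)%E.
    by rewrite /I /Rintegral fineK//; exact: integrable_fin_num.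
  - exact/measurable_EFinP.
  - by move=> y; rewrite lee_fin.
have phE u : phi (u +i* q) = - (cI * mu%:C * (u +i* q)) +
    alpha%:C * (vg_logmod a1' a2' c u +i* vg_arg a1' a2' c u).
  rewrite /phi /VG_exponent VG_exponent_base//; last first.
    by case/andP: cah => _ ->; rewrite hs1.
  by rewrite -clog_vg_base.
(* What does not depend on [u]: the modulus of [e^(i xi l)], the discounting, and the [1 / M] by
   which [vg_modulus_shift] relates the tilted transform to [rho]. *)
pose B := expR (c * l - tau * r) / M.
have trE u : call_transform phi r K s tau (u +i* q) =
    (B * (rho u * (cos (u * l + ph u + 0) * chat c u + sin (u * l + ph u + 0) * shat c u))) +i*
    (B * (rho u * (cos (u * l + ph u - pi / 2) * chat c u + sin (u * l + ph u - pi / 2) * shat c u))).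
  have ixi : cI * (u +i* q) = c +i* u by rewrite /cI /c; simpc.
  rewrite /call_transform phE ixi call_kernel// -/l.
  rewrite (_ : _ - tau%:C * _ = (c * l - tau * r + (c * m - p * vg_logmod a1' a2' c u)) +i*
      (u * l + (u * m - p * vg_arg a1' a2' c u))); last first.
    rewrite (_ : cI * mu%:C * (u +i* q) = mu%:C * (c +i* u)); last by rewrite -ixi; ring.
    by simpc; congr (_ +i* _); rewrite /m /p; ring.
  rewrite cexp_polar expRD -vg_modulusE -vg_phaseE /rho /ph vg_modulus_shift vg_phase_shift.
  rewrite -/a1' -/a2' -/M addr0 cosB sinB cos_pihalf sin_pihalf !mulr0 !mulr1 add0r sub0r.
  rewrite /polar /B; simpc.
  by congr (_ +i* _); field; rewrite gt_eqF.
split.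
- apply/integrableP; split.
    apply/measurable_EFinP; rewrite (_ : call_integrand _ _ _ _ _ _ = (fun y =>
      C * (expR ((hstar + c) * y) * call_tilt c (y + l)) * f y tau)).
      exact: measurable_funM.
    by apply/funext => y; exact: ciE.
  under eq_integral => y _.
    rewrite gee0_abs; last by rewrite lee_fin ciE mulr_ge0.
    over.
  by rewrite intE ltry.
- split.
    under eq_fun do rewrite trE /= EFinM.
    exact: integrableZl.
  under eq_fun do rewrite trE /= EFinM.
  exact: integrableZl.
(* [eIm] makes the imaginary component 0; in the real one the [2 * pi] of [eRe] cancels the
   prefactor. *)
- rewrite /line_integral /cintegral.
  under eq_Rintegral do rewrite trE /=.
  under [X in _ +i* X]eq_Rintegral do rewrite trE /=.
  rewrite !RintegralZl// eRe eIm.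
  rewrite /call_price /Rintegral intE /= /C /B; simpc.
  congr (_ +i* _); rewrite expRD (mulrC r).
  have := pi_gt0 R; generalize (@pi R) => z z0; field.
  by rewrite !gt_eqF.
Qed.
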